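(* Let $\mathbb{F}_q$ be a finite field. If $\alpha \in \mathbb{F}_q((t^{-1}))$ is a Pisot--Vijayaraghavan element, then $([\alpha^n])_{n\in\mathbb{N}}$ is a rigidity sequence in (the additive group of) $\mathbb{F}_q[t]$.
   Context: Let $\mathcal{Z}=\mathbb{F}_q[t]$, $\mathcal{Q}=\mathbb{F}_q(t)$, $\mathcal{R}=\mathbb{F}_q((t^{-1}))$, with absolute value $\left|\sum_{n=-\infty}^N c_nt^n\right| = q^N$ when $c_N\neq0$ (and $|0|=0$). For $x=\sum_{n=-\infty}^N c_nt^n\in\mathcal{R}$, the integer part is $[x]=\sum_{n=0}^N c_nt^n\in\mathcal{Z}$. The absolute value extends to the algebraic closure of $\mathcal{R}$ by $|\alpha| = |N_{\mathcal{R}(\alpha)/\mathcal{R}}(\alpha)|^{1/d}$ if $\alpha$ has degree $d$ over $\mathcal{R}$. An element $\alpha\in\mathcal{R}\setminus\mathbb{F}_q$ is a Pisot--Vijayaraghavan (PV) element if $\alpha$ is integral over $\mathcal{Z}$ and all of its conjugates over $\mathcal{Q}$ (other than $\alpha$ itself) have absolute value less than $1$. For a countable discrete abelian group $\Gamma$ (here $\Gamma=(\mathcal{Z},+)$), a measure-preserving system is a quadruple $(X, \mathcal{B}, \mu, (T_g)_{g \in \Gamma})$, where $(X,\mathcal{B},\mu)$ is a non-atomic Lebesgue probability space and $(T_g)_{g\in\Gamma}$ is an action of $\Gamma$ by measure-preserving transformations. A sequence $(a_n)_{n\in\mathbb{N}}$ in $\Gamma$ is a rigidity sequence for the system if $\|f\circ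 T_{a_n} - f\|_2 \to 0$ for every $f \in L^2(\mu)$. The system is weakly mixing if $\frac{1}{|\Phi_N|}\sum_{g\in\Phi_N} |\mu(A\cap T_gB)-\mu(A)\mu(B)| \to 0$ for all $A,B\in\mathcal{B}$ and every F{\o}lner sequence $(\Phi_N)$ in $\Gamma$ (finite nonempty sets with $|(\Phi_N+x)\triangle\Phi_N|/|\Phi_N|\to0$ for every $x\in\Gamma$). The standalone term ''rigidity sequence'' means a sequence that is a rigidity sequence for some weakly mixing system. *)

(* Defs.v *)
From HB Require Import structures.
From mathcomp Require Import all_boot all_order all_algebra all_field.
From mathcomp Require Import finmap all_classical all_reals all_analysis.
From mathcomp Require Import generic_quotient fraction zify ring.

Set Implicit Arguments.
Unset Strict Implicit.
Unset Printing Implicit Defensive.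

Import Order.TTheory GRing.Theory Num.Theory.
Import numFieldNormedType.Exports.

Local Open Scope classical_set_scope.
Local Open Scope ring_scope.

(** * The field F((t^-1)) *)

(* A series [x = \sum_(n <= N) c_n t^n] is encoded by [n |-> c_n]. *)
Definition bounded_above (F : fieldType) (c : int -> F) (N : int) : Prop :=
  forall n, N < n -> c n = 0.

Record laurent (F : fieldType) := Laurent {
  lcoef :> int -> F;
  _ : `[< exists N, bounded_above lcoef N >] }.

HB.instance Definition _ (F : fieldType) := [isSub for @lcoef F].
HB.instance Definition _ (F : fieldType) := [Choice of laurent F by <:].

Section LaurentField.
Variable F : fieldType.
Implicit Types (x y z : laurent F) (M N n : int) (m K : nat).

Lemma laurent_ext x y : (forall n, x n = y n) -> x = y.
Proof. by move=> xy; apply/val_inj/funext => n; exact: xy. Qed.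

Lemma laurent_bound x : exists N, bounded_above x N.
Proof. by case: x => c /= /asboolP. Qed.

Lemma bounded_above_le (c : int -> F) M N :
  M <= N -> bounded_above c M -> bounded_above c N.
Proof. by move=> MN cM n Nn; apply: cM; exact: le_lt_trans Nn. Qed.

Lemma laurent_bound2 x y : exists N, bounded_above x N /\ bounded_above y N.
Proof.
have [M xM] := laurent_bound x; have [N yN] := laurent_bound y.
exists (Num.max M N); split.
  by apply: bounded_above_le xM; rewrite le_max lexx.
by apply: bounded_above_le yN; rewrite le_max lexx orbT.
Qed.

Definition mkLaurent (c : int -> F) (cP : exists N, bounded_above c N) :
  laurent F := Laurent (asboolT cP).

Fact lzero_subproof : exists N, bounded_above (fun=> 0 : F) N.
Proof. by exists 0. Qed.
Definition lzero := mkLaurent lzero_subproof.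

Fact ladd_subproof x y : exists N, bounded_above (fun n => x n + y n) N.
Proof.
have [N [xN yN]] := laurent_bound2 x y.
by exists N => n Nn; rewrite xN// yN// addr0.
Qed.
Definition ladd x y := mkLaurent (ladd_subproof x y).

Fact lopp_subproof x : exists N, bounded_above (fun n => - x n) N.
Proof. by have [N xN] := laurent_bound x; exists N => n Nn; rewrite xN// oppr0. Qed.
Definition lopp x := mkLaurent (lopp_subproof x).

(* Only finitely many [k] contribute. *)
Definition lconv (c c' : int -> F) (n : int) : F :=
  \sum_(k \in [set: int]) c k * c' (n - k).

Lemma lconv_bounded (c c' : int -> F) M N : bounded_above c M ->
  bounded_above c' N -> bounded_above (lconv c c') (M + N).
Proof.
move=> cM cN n MNn; apply: fsbig1 => k _.
have [Mk|kM] := ltP M k; first by rewrite cM// mul0r.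
by rewrite cN ?mulr0//; lia.
Qed.

Fact lmul_subproof x y : exists N, bounded_above (lconv x y) N.
Proof.
have [M xM] := laurent_bound x; have [N yN] := laurent_bound y.
by exists (M + N); exact: lconv_bounded.
Qed.
Definition lmul x y := mkLaurent (lmul_subproof x y).

Fact lone_subproof : exists N, bounded_above (fun n => (n == 0)%:R : F) N.
Proof. by exists 0 => n n0; rewrite gt_eqF. Qed.
Definition lone := mkLaurent lone_subproof.

Fact laddA : associative ladd.
Proof. by move=> x y z; apply: laurent_ext => n /=; rewrite addrA. Qed.
Fact laddC : commutative ladd.
Proof. by move=> x y; apply: laurent_ext => n /=; rewrite addrC. Qed.
Fact ladd0 : left_id lzero ladd.
Proof. by move=> x; apply: laurent_ext => n /=; rewrite add0r. Qed.
Fact laddN : left_inverse lzero lopp ladd.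
Proof. by move=> x; apply: laurent_ext => n /=; rewrite addNr. Qed.

HB.instance Definition _ :=
  GRing.isZmodule.Build (laurent F) laddA laddC ladd0 laddN.

(* The first [K] coefficients from [t^N] downwards, as a polynomial; products
   of series reduce to products of these polynomials. *)
Definition ltrunc (c : int -> F) N K : {poly F} := \poly_(i < K) c (N - i%:Z).

Lemma lconvE (c c' : int -> F) M N m K : bounded_above c M ->
    bounded_above c' N -> (m < K)%N ->
  lconv c c' (M + N - m%:Z) = (ltrunc c M K * ltrunc c' N K)`_m.
Proof.
move=> cM cN mK; rewrite /lconv (fsbigE [seq M - i%:Z | i <- iota 0 m.+1]).
- rewrite big_map -[iota 0 _]/(index_iota 0 m.+1).
  under eq_bigl do rewrite in_setT.
  rewrite big_mkord coefM; apply: eq_bigr => i _.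
  have im := ltn_ord i; rewrite !coef_poly !ifT; [|lia..].
  by congr (_ * c' _); lia.
- by rewrite map_inj_uniq ?iota_uniq// => i j; lia.
- by [].
- move=> k _ kr; have [Mk|kM] := ltP M k; first by rewrite cM// mul0r.
  rewrite cN ?mulr0// ltNge; apply: contra kr => ?.
  by apply/mapP; exists `|M - k|%N; [rewrite mem_iota; lia|lia].
Qed.

Lemma laurent_ext_le x y N : bounded_above x N -> bounded_above y N ->
  (forall m, x (N - m%:Z) = y (N - m%:Z)) -> x = y.
Proof.
move=> xN yN xy; apply: laurent_ext => n.
have [Nn|nN] := ltP N n; first by rewrite xN// yN.
by have -> : n = N - `|N - n|%N%:Z by lia.
Qed.

Lemma coef_mul_low (p p' q q' : {poly F}) m :
  (forall i, (i <= m)%N -> p`_i = p'`_i) ->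
  (forall i, (i <= m)%N -> q`_i = q'`_i) -> (p * q)`_m = (p' * q')`_m.
Proof.
move=> pp qq; rewrite !coefM; apply: eq_bigr => i _.
by rewrite pp ?qq//; have := ltn_ord i; lia.
Qed.

Lemma coef_ltrunc_conv (c c' : int -> F) M N K i : bounded_above c M ->
    bounded_above c' N -> (i < K)%N ->
  (ltrunc (lconv c c') (M + N) K)`_i = (ltrunc c M K * ltrunc c' N K)`_i.
Proof. by move=> cM cN iK; rewrite coef_poly iK; exact: lconvE. Qed.

Fact lmulC : commutative lmul.
Proof.
move=> x y; have [M xM] := laurent_bound x; have [N yN] := laurent_bound y.
apply: (@laurent_ext_le _ _ (M + N)) => [||m]; first exact: lconv_bounded.
  by rewrite addrC; exact: lconv_bounded.
rewrite /= (@lconvE _ _ _ _ _ m.+1)// mulrC (addrC M).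
by rewrite (@lconvE _ _ _ _ _ m.+1).
Qed.

Fact lmulA : associative lmul.
Proof.
move=> x y z; have [M xM] := laurent_bound x; have [N yN] := laurent_bound y.
have [P zP] := laurent_bound z.
have xy := lconv_bounded xM yN; have yz := lconv_bounded yN zP.
apply: (@laurent_ext_le _ _ (M + (N + P))) => [||m].
- exact: lconv_bounded.
- by rewrite addrA; exact: lconv_bounded.
rewrite /= (@lconvE _ _ _ _ _ m.+1)// addrA (@lconvE _ _ _ _ _ m.+1)//.
transitivity (ltrunc x M m.+1 * (ltrunc y N m.+1 * ltrunc z P m.+1))`_m.
  by apply: coef_mul_low => // i im; rewrite coef_ltrunc_conv.
by rewrite mulrA; apply: coef_mul_low => // i im; rewrite coef_ltrunc_conv.
Qed.

Fact lmul1 : left_id lone lmul.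
Proof.
move=> x; have [N xN] := laurent_bound x.
have b1 : bounded_above lone 0 by move=> n n0 /=; rewrite gt_eqF.
apply: (@laurent_ext_le _ _ (0 + N)) => [||m]; first exact: lconv_bounded.
  by rewrite add0r.
rewrite /= (@lconvE _ _ _ _ _ m.+1)// add0r.
have -> : ltrunc lone 0 m.+1 = 1.
  apply/polyP => i; rewrite coef_poly coef1 /=.
  by case: i => [|i] //=; rewrite ?subr0// if_same.
by rewrite mul1r coef_poly ltnSn.
Qed.

Fact lmulDl : left_distributive lmul ladd.
Proof.
move=> x y z; have [M [xM yM]] := laurent_bound2 x y.
have [N zN] := laurent_bound z.
have xyM : bounded_above (ladd x y) M.
  by move=> n Mn /=; rewrite xM// yM// addr0.
apply: (@laurent_ext_le _ _ (M + N)) => [||m]; first exact: lconv_bounded.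
  by move=> n Mn /=; rewrite !(@lconv_bounded _ _ M N)// addr0.
rewrite /= !(@lconvE _ _ _ _ _ m.+1)// -coefD -mulrDl.
apply: coef_mul_low => // i im.
by rewrite coefD !coef_poly; case: ifP; rewrite ?addr0.
Qed.

Fact lone_neq0 : lone != lzero.
Proof.
by apply/eqP => /(congr1 (fun x : laurent F => x 0)) /= /eqP; rewrite oner_eq0.
Qed.

HB.instance Definition _ := GRing.Zmodule_isComNzRing.Build (laurent F)
  lmulA lmulC lmul1 lmulDl lone_neq0.

Definition is_ldeg x N : Prop := x N != 0 /\ bounded_above x N.

(* The [N] with [c_N <> 0] and [c_n = 0] for [n > N]; a junk value at [x = 0]. *)
Definition ldeg x : int := xget 0 [set N | is_ldeg x N].

Lemma ldegP x : x != 0 -> is_ldeg x (ldeg x).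
Proof.
move=> x0; suff [N xN] : exists N, is_ldeg x N.
  exact: (@xgetPex _ 0 [set N | is_ldeg x N] (ex_intro _ N xN)).
have [M xM] := laurent_bound x.
have ex : exists m : nat, x (M - m%:Z) != 0.
  apply/not_existsP => xm; case/eqP: x0; apply: (laurent_ext_le xM) => // m.
  by apply/eqP/negP => /negP/xm.
exists (M - (ex_minn ex)%:Z); case: ex_minnP => m xm mmin; split=> // n nm.
have [Mn|nM] := ltP M n; first exact: xM.
apply/eqP; apply: contraTT nm => xn; rewrite -leNgt.
have /mmin : x (M - `|M - n|%N%:Z) != 0.
  by rewrite (_ : M - _ = n)//; lia.
lia.
Qed.

Fixpoint series_inv_seq (c : nat -> F) (n : nat) : seq F :=
  if n is k.+1 then
    let s := series_inv_seq c k in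
    rcons s ((c 0)^-1 * ((k == 0)%:R - \sum_(i < k) s`_i * c (k - i)%N))
  else [::].

Lemma series_inv (c : nat -> F) : c 0 != 0 ->
  exists s : nat -> F,
    forall m, \sum_(i < m.+1) s i * c (m - i)%N = (m == 0)%:R.
Proof.
move=> c0; exists (fun k : nat => (series_inv_seq c k.+1)`_k) => m.
have sz k : size (series_inv_seq c k) = k.
  by elim: k => //= k IH; rewrite size_rcons IH.
have stab k i : (i < k)%N ->
    (series_inv_seq c i.+1)`_i = (series_inv_seq c k)`_i.
  elim: k => // k IH; rewrite ltnS leq_eqVlt => /orP[/eqP-> //|ik].
  by rewrite IH//= nth_rcons sz ik.
have last_m : (series_inv_seq c m.+1)`_m * c 0%N =
    (m == 0)%:R - \sum_(i < m) (series_inv_seq c m)`_i * c (m - i)%N.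
  by rewrite /= nth_rcons sz ltnn eqxx mulrAC mulVf// mul1r.
rewrite big_ord_recr subnn -[LHS]/(_ + (series_inv_seq c m.+1)`_m * c 0%N).
rewrite last_m addrC.
rewrite [X in _ + X](eq_bigr
  (fun i : 'I_m => (series_inv_seq c m)`_i * c (m - i)%N)).
  by rewrite subrK.
by move=> i _; congr (_ * _); exact: (stab m i (ltn_ord i)).
Qed.

Lemma laurent_inv x : x != 0 -> exists y, y * x = 1.
Proof.
move=> /ldegP; set N := ldeg x => -[xN0 xN].
have [|s sP] := @series_inv (fun i => x (N - i%:Z)); first by rewrite subr0.
pose c n := if n <= - N then s `|- N - n|%N else 0.
have cN : bounded_above c (- N) by move=> n nN; rewrite /c leNgt nN.
have [y yE] : exists y, lcoef y = c by exists (mkLaurent (ex_intro _ _ cN)).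
exists y; apply: (@laurent_ext_le _ _ (- N + N)) => [||m].
- by apply: lconv_bounded => //; rewrite yE.
- by rewrite addNr => n n0; rewrite /= gt_eqF.
rewrite /= (@lconvE _ _ _ _ _ m.+1) ?yE// addNr sub0r oppr_eq0 coefM.
rewrite -[m%:Z == 0]/(m == 0)%N -sP; apply: eq_bigr => i _.
have im := ltn_ord i; rewrite !coef_poly !ifT; [|lia..].
rewrite /c ifT; last lia.
by congr (s _ * x _); lia.
Qed.

Definition linv x : laurent F :=
  if x == 0 then 0 else xget 0 [set y | y * x = 1].

Fact lmulV x : x != 0 -> linv x * x = 1.
Proof.
move=> x0; rewrite /linv (negbTE x0); have [y yx] := laurent_inv x0.
exact: (@xgetPex _ 0 [set y | y * x = 1] (ex_intro _ y yx)).
Qed.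

Fact linv0 : linv 0 = 0.
Proof. by rewrite /linv eqxx. Qed.

HB.instance Definition _ :=
  GRing.ComNzRing_isField.Build (laurent F) lmulV linv0.

(** The embeddings of F[t] and F(t), and the integer part *)

Definition poly_coefz (p : {poly F}) (n : int) : F :=
  if n is Posz k then p`_k else 0.

Fact poly_laurent_subproof (p : {poly F}) :
  exists N, bounded_above (poly_coefz p) N.
Proof. by exists (size p)%:Z => -[n|n] //= ?; rewrite nth_default//; lia. Qed.
Definition poly_laurent (p : {poly F}) : laurent F :=
  mkLaurent (poly_laurent_subproof p).

Fact poly_laurent_is_zmod_morphism : zmod_morphism poly_laurent.
Proof.
move=> p q; apply: laurent_ext => -[n|n] /=; first by rewrite coefB.
by rewrite subr0.
Qed.

Fact poly_laurent_is_monoid_morphism : monoid_morphism poly_laurent.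
Proof.
split; first by apply: laurent_ext => -[n|n] //=; rewrite coef1.
move=> p q; apply: laurent_ext => -[n|n] /=; last first.
  rewrite /lconv fsbig1// => -[k|k] _; rewrite /= ?mul0r//.
  by rewrite (_ : Negz n - k%:Z = Negz (n + k)%N) /= ?mulr0//; lia.
rewrite /lconv (fsbigE [seq i%:Z | i <- iota 0 n.+1]).
- rewrite big_map -[iota 0 _]/(index_iota 0 n.+1).
  under eq_bigl do rewrite in_setT.
  rewrite big_mkord coefM; apply: eq_bigr => i _.
  by have im := ltn_ord i; rewrite (_ : n%:Z - i%:Z = (n - i)%N%:Z)//; lia.
- by rewrite map_inj_uniq ?iota_uniq// => i j [].
- by [].
- move=> [k|k] _ kr; rewrite /= ?mul0r//.
  have nk : (n < k)%N.
    rewrite ltnNge; apply: contra kr => kn.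
    by apply/mapP; exists k => //; rewrite mem_iota; lia.
  by rewrite (_ : n%:Z - k%:Z = Negz (k - n).-1) /= ?mulr0//; lia.
Qed.

HB.instance Definition _ := GRing.isZmodMorphism.Build {poly F} (laurent F)
  poly_laurent poly_laurent_is_zmod_morphism.
HB.instance Definition _ := GRing.isMonoidMorphism.Build {poly F} (laurent F)
  poly_laurent poly_laurent_is_monoid_morphism.

Lemma poly_laurent_inj : injective poly_laurent.
Proof.
by move=> p q pq; apply/polyP => i; have := congr1 (fun x => lcoef x i%:Z) pq.
Qed.

Lemma poly_laurent_eq0 p : (poly_laurent p == 0) = (p == 0).
Proof. by rewrite -(rmorph0 poly_laurent) (inj_eq poly_laurent_inj). Qed.

Definition frac_laurent (r : {fraction {poly F}}) : laurent F :=
  poly_laurent (repr r).1 / poly_laurent (repr r).2.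

Local Open Scope quotient_scope.

Lemma frac_laurent_pi (u : {ratio {poly F}}) :
  frac_laurent (\pi_{fraction {poly F}} u) =
    poly_laurent u.1 / poly_laurent u.2.
Proof.
apply/eqP; rewrite /frac_laurent eqr_div ?poly_laurent_eq0 ?denom_ratioP//.
rewrite -!rmorphM (inj_eq poly_laurent_inj) FracField.equivf_l.
by rewrite mulrC.
Qed.

Fact frac_laurent_is_zmod_morphism : zmod_morphism frac_laurent.
Proof.
move=> r1 r2; rewrite -[r1]reprK -[r2]reprK; move: (repr r1) (repr r2) => u v.
rewrite [- _](_ : _ = \pi_{fraction {poly F}} (FracField.oppf v)); last first.
  exact/esym/FracField.pi_opp.
rewrite [_ + _](_ : _ = \pi_{fraction {poly F}}
  (FracField.addf u (FracField.oppf v))); last exact/esym/FracField.pi_add.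
have [u0 v0] := (denom_ratioP u, denom_ratioP v).
rewrite !frac_laurent_pi /FracField.addf /FracField.oppf.
rewrite !numden_Ratio ?mulf_neq0//.
rewrite mulNr rmorphB !rmorphM /=; field.
by rewrite !poly_laurent_eq0 u0 v0.
Qed.

Fact frac_laurent_is_monoid_morphism : monoid_morphism frac_laurent.
Proof.
split.
  rewrite [1](_ : _ = \pi_{fraction {poly F}} (Ratio 1 1)); last first.
    by rewrite -[1]/(FracField.tofrac 1) piE.
  by rewrite frac_laurent_pi !numden_Ratio ?oner_eq0// rmorph1 divr1.
move=> r1 r2; rewrite -[r1]reprK -[r2]reprK; move: (repr r1) (repr r2) => u v.
rewrite [_ * _](_ : _ = \pi_{fraction {poly F}} (FracField.mulf u v)); last first.
  exact/esym/FracField.pi_mul.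
have [u0 v0] := (denom_ratioP u, denom_ratioP v).
rewrite !frac_laurent_pi /FracField.mulf !numden_Ratio ?mulf_neq0//.
rewrite !rmorphM /=; field.
by rewrite !poly_laurent_eq0 u0 v0.
Qed.

HB.instance Definition _ :=
  GRing.isZmodMorphism.Build {fraction {poly F}} (laurent F)
    frac_laurent frac_laurent_is_zmod_morphism.
HB.instance Definition _ :=
  GRing.isMonoidMorphism.Build {fraction {poly F}} (laurent F)
    frac_laurent frac_laurent_is_monoid_morphism.

Local Close Scope quotient_scope.

(* The absolute value is harmless: all coefficients above [ldeg x] vanish, so
   for [ldeg x < 0] this is the zero polynomial. *)
Definition int_part x : {poly F} := \poly_(i < `|ldeg x|%N.+1) x i%:Z.

End LaurentField.

(** * Absolute values and Pisot--Vijayaraghavan elements *)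

Definition laurent_abs (R : realType) (F : finFieldType) (x : laurent F) : R :=
  if x == 0 then 0 else #|F|%:R ^ ldeg x.

(* The norm [N_(E/K)(x)] of [x \in E]: the determinant of multiplication by [x]
   on [E], in the basis [vbasis E] over [K]. *)
Definition field_norm (K : fieldType) (L : fieldExtType K) (E : {subfield L})
    (x : L) : K :=
  \det (\matrix_(i < \dim E, j < \dim E)
    coord (vbasis E) j (x * (vbasis E)`_i)).

(* The algebraic closure enters only through its finite subextensions [L]:
   both [|x|] and conjugacy depend on [K(x)] alone. *)
Definition ext_abs (R : realType) (F : finFieldType)
    (L : fieldExtType (laurent F)) (x : L) : R :=
  laurent_abs R (field_norm <<1; x>>%AS x) `^ (adjoin_degree 1 x)%:R^-1.

Definition conjugate (F : finFieldType) (L : fieldExtType (laurent F))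
    (alpha : laurent F) (beta : L) : Prop :=
  exists p : {poly {fraction {poly F}}},
    [/\ irreducible_poly p,
        root (map_poly (@frac_laurent F) p) alpha &
        root (map_poly (in_alg L \o @frac_laurent F) p) beta].

Definition PV_element (R : realType) (F : finFieldType) (alpha : laurent F) :
    Prop :=
  [/\ forall c : F, alpha <> poly_laurent c%:P,
      integralOver (@poly_laurent F) alpha &
      forall (L : fieldExtType (laurent F)) (beta : L),
        conjugate alpha beta -> beta <> alpha%:A -> ext_abs R beta < 1].

(** * Measure-preserving systems *)

(* The sigma-algebra on which [completed_lebesgue_measure] is defined. *)
Definition lebesgue_measurable (R : realType) : set (set R) :=
  ((@wlength R idfun)^*)%mu.-cara.-measurable.

(* Rokhlin's definition: [(X, mu)] is complete and isomorphic mod 0 to [[0, 1]]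
   with the Lebesgue measure on the Lebesgue-measurable sets. *)
Definition nonatomic_lebesgue_space (R : realType) (d : measure_display)
    (X : measurableType d) (mu : probability X R) : Prop :=
  let lambda := @completed_lebesgue_measure R in
  measure_is_complete mu /\
  exists (X0 : set X) (I0 : set R) (phi : X -> R),
    [/\ measurable X0 /\ mu X0 = 1%E,
        [/\ I0 `<=` `[0, 1], lebesgue_measurable I0 & lambda I0 = 1%E],
        set_bij X0 I0 phi,
        forall A, A `<=` X0 -> measurable A <-> lebesgue_measurable (phi @` A) &
        forall A, A `<=` X0 -> measurable A -> lambda (phi @` A) = mu A].

Section Systems.
Context (R : realType) (G : countZmodType).

Record measure_preserving_action (d : measure_display) (X : measurableType d)
    (mu : probability X R) (T : G -> X -> X) : Prop := {
  action0 : forall x, T 0 x = x;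
  actionD : forall g h x, T (g + h) x = T g (T h x);
  action_measurable : forall g, measurable_fun setT (T g);
  action_preserving : forall g A, measurable A -> mu (T g @^-1` A) = mu A }.

Definition rigid_along (d : measure_display) (X : measurableType d)
    (mu : probability X R) (T : G -> X -> X) (a : nat -> G) : Prop :=
  forall f : X -> R, f \in Lfun mu 2%:E ->
    ('N[mu]_2%:E[EFin \o (fun x => f (T (a n) x) - f x)%R])%E
      @[n --> \oo] --> 0%E.

Definition folner (Phi : nat -> {fset G}) : Prop :=
  (forall N, Phi N != fset0) /\
  forall x : G,
    let shift N := [fset (g + x)%R | g in Phi N]%fset in
    #|` ((shift N `\` Phi N) `|` (Phi N `\` shift N))%fset|%:R / #|` Phi N|%:R
      @[N --> \oo] --> (0 : R).

Definition weakly_mixing (d : measure_display) (X : measurableType d)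
    (mu : probability X R) (T : G -> X -> X) : Prop :=
  forall (A B : set X) (Phi : nat -> {fset G}),
    measurable A -> measurable B -> folner Phi ->
    (#|` Phi N|%:R)^-1 * \sum_(g <- Phi N)
      `|fine (mu (A `&` T g @` B)) - fine (mu A) * fine (mu B)|
      @[N --> \oo] --> (0 : R).

Definition rigidity_sequence (a : nat -> G) : Prop :=
  exists (d : measure_display) (X : measurableType d) (mu : probability X R)
      (T : G -> X -> X),
    [/\ nonatomic_lebesgue_space mu, measure_preserving_action mu T,
        weakly_mixing mu T & rigid_along mu T a].

End Systems.

(* Main.v *)
(* Dynamics. Suppose that [G] carries characters [chi k : G -> F], finitely many
   of them nonzero at each point, which are jointly onto.  Let [X_0] be a point
   and let [X_(k+1)] consist of a position [c] in [F], a switch that is on with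
   probability [1/(k+2)], and independent uniform points [z c'] of [X_k], one
   for each [c' : F]; the point of [X_k] below is [z c] when the switch is on and
   [z 0] when it is off.  Letting [g] move [c] by [chi k g] makes [G] act on the
   limit of this tower, and by induction, for events [A], [B] seen at level [n],
     [mu (A & g B) - mu A mu B = w (mu_n (A & g B) - mu A mu B)],
   where [w] is the product of the [1 - 1/(k+2)] over the [k >= n] such that
   [chi k g <> 0].  Since [\sum 1/(k+2)] diverges, [w] averages to [0] along
   every Folner sequence: the action is weakly mixing.  It is rigid along [a]
   as soon as [chi k (a n)] vanishes for all [k] except at most one, which tends
   to infinity with [n].  Levels are unions of free orbits, so [X_(k+1)] is
   equivariantly a product over [X_k], and [X] can be realised on [[0, 1)] with
   each [g] permuting intervals of equal length by translations.

   Algebra. Let [P = (x - alpha) Q] be the minimal polynomial of [alpha] over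
   [F(t)]; it has coefficients in [F[t]] and is separable.  By Hensel's lemma an
   irreducible factor of [Q] over [F((1/t))], having constant term of absolute
   value [< 1], has all its nonleading coefficients of absolute value [< 1], so
   the trace of [x^n] modulo [Q] tends to [0], while
   [alpha^n + Tr_Q (x^n) = Tr_P (x^n)] is a polynomial.  Hence the coefficient of
   [t^-1] in [alpha^n] is eventually [0], and the characters
     [g |-> coefficient of t^-1 in g alpha^-k],
   for [k] in a sufficiently sparse sequence, are as required for
   [a n = [alpha^n]]. *)
From HB Require Import structures.
From mathcomp Require Import all_boot all_order all_algebra all_field.
From mathcomp Require Import finmap all_classical all_reals all_analysis.
From mathcomp Require Import measurable_realfun.
From mathcomp Require Import generic_quotient fraction zify ring lra.
Require Import Defs.

Set Implicit Arguments.
Unset Strict Implicit.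
Unset Printing Implicit Defensive.

Import Order.TTheory GRing.Theory Num.Theory.
Import numFieldNormedType.Exports.

Local Open Scope classical_set_scope.
Local Open Scope ring_scope.


(** * Lebesgue measure on [0, 1) *)

Section UnitInterval.
Variable R : realType.
Implicit Types (A B X : set R) (t : R).

Local Notation lam := (@completed_lebesgue_measure R).
Local Notation lmeas := (@lebesgue_measurable R).
Local Notation I01 := (`[0, 1[ : set R).

Definition translate t A : set R := [set x | A (x + t)].

Lemma wlength_translate t A : R.-ocitv.-measurable A ->
  R.-ocitv.-measurable (translate t A) /\
  wlength (R := R) idfun (translate t A) = wlength idfun A.
Proof.
move=> [[a b] _ <-] /=.
have -> : translate t `]a, b] = `](a - t), (b - t)]%classic.
  apply/seteqP; split=> x; rewrite /translate /= !in_itv /=;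
  by rewrite ltrBlDr lerBrDr.
split; first exact: is_ocitv.
by rewrite !wlength_itv /= !lte_fin ltrD2r -!EFinB opprB addrA subrK.
Qed.

Lemma lam_translate t A : lam (translate t A) = lam A.
Proof.
suff le_tr s X : (lam (translate s X) <= lam X)%E.
  apply/eqP; rewrite eq_le le_tr /=.
  have := le_tr (- t) (translate t A).
  have -> : translate (- t) (translate t A) = A; last by [].
  by apply/seteqP; split=> x; rewrite /translate /= subrK.
apply: le_ereal_inf_tmp => _ /= [F [mF XF] <-].
apply: ereal_inf_lbound; exists (fun k => translate s (F k)).
  split=> [k|x /XF [k _ Fk]]; last by exists k.
  by have [] := wlength_translate s (mF k).
by apply: eq_eseriesr => k _; have [] := wlength_translate s (mF k).
Qed.

Lemma lmeas_translate t A : lmeas A -> lmeas (translate t A).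
Proof.
move=> mA; suff : caratheodory_measurable lam (translate t A) by [].
move=> X; have E : lam (translate (- t) X) =
    (lam (translate (- t) X `&` A) + lam (translate (- t) X `&` ~` A))%E.
  exact: mA.
rewrite -(lam_translate (- t) X) E.
rewrite -(lam_translate (- t) (X `&` _)) -(lam_translate (- t) (X `&` ~` _)).
by congr (lam _ + lam _)%E; apply/seteqP; split=> x;
  rewrite /translate /= subrK.
Qed.

Lemma lmeas_itv (i : interval R) : lmeas [set` i].
Proof.
by apply: sub_caratheodory; exact: (@measurable_itv R i).
Qed.

Lemma lam_itv (i : interval R) :
  lam [set` i] = (if i.1 < i.2 then (i.2 : \bar R) - i.1 else 0)%E.
Proof. exact: lebesgue_measure_itv. Qed.

End UnitInterval.

Section GridApproximation.
Variable R : realType.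
Implicit Types (A B X : set R) (e : R).

Local Notation lam := (@completed_lebesgue_measure R).
Local Notation lmeas := (@lebesgue_measurable R).
Local Notation I01 := (`[0, 1[%classic : set R).

Definition grid (N : nat) (P : pred nat) : set R :=
  [set x | I01 x /\ P (Num.truncn (N%:R * x))].

Definition sdiff (T : Type) (A B : set T) : set T := (A `\` B) `|` (B `\` A).

Definition grid_approx A := forall e, 0 < e -> exists M, forall N, (M <= N)%N ->
  exists P, (lam (sdiff (A `&` I01) (grid N P)) <= e%:E)%E.

Lemma le_lam A B : A `<=` B -> (lam A <= lam B)%E.
Proof. exact: (@le_outer_measure _ _ ((@wlength R idfun)^*)%mu). Qed.

Lemma lamU2 A B : (lam (A `|` B) <= lam A + lam B)%E.
Proof. exact: (@outer_measureU2 _ _ ((@wlength R idfun)^*)%mu). Qed.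

Lemma lam_bigcup (F : (set R)^nat) :
  (lam (\bigcup_k F k) <= \sum_(0 <= k <oo) lam (F k))%E.
Proof.
exact: (@outer_measure_sigma_subadditive _ _ ((@wlength R idfun)^*)%mu).
Qed.

Lemma lam_bigcup_tail (F : (set R)^nat) N :
  (lam (\bigcup_(k in ~` `I_N) F k) <= \sum_(N <= k <oo) lam (F k))%E.
Proof.
exact: (@outer_measure_sigma_subadditive_tail _ _ ((@wlength R idfun)^*)%mu).
Qed.

Lemma lam_ge0 A : (0 <= lam A)%E.
Proof. exact: (@outer_measure_ge0 _ _ ((@wlength R idfun)^*)%mu). Qed.

Lemma grid_approx0 : grid_approx set0.
Proof.
move=> e e0; exists 0%N => N _; exists pred0.
rewrite (_ : sdiff _ _ = set0) ?measure0 ?lee_fin ?ltW//.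
by apply/seteqP; split=> x //= -[[[]]|[[]]].
Qed.

Lemma grid_approxU A B : grid_approx A -> grid_approx B -> grid_approx (A `|` B).
Proof.
move=> gA gB e e0; have e20 : 0 < e / 2 by rewrite divr_gt0.
have [M MP] := gA _ e20; have [M' MP'] := gB _ e20.
exists (maxn M M') => N; rewrite geq_max => /andP[/MP[P PA] /MP'[Q QB]].
exists (predU P Q); rewrite [e in e%:E]splitr EFinD.
apply: le_trans (leeD PA QB); apply: le_trans (lamU2 _ _); apply: le_lam.
move=> x; rewrite /sdiff /grid /=.
have ff : ~ is_true false by []; have tt : is_true true by [].
by case: (P _); case: (Q _) => /=; tauto.
Qed.

Lemma grid_approx_itv (a b : R) : grid_approx `]a, b].
Proof.
move=> e e0; exists (Num.truncn (2 / e)).+1 => N MN.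
have N0 : (0 < N%:R :> R) by rewrite ltr0n; exact: leq_ltn_trans MN.
have Ne : N%:R^-1 <= e / 2.
  have e20 : 0 < 2 / e by rewrite divr_gt0.
  rewrite -[leRHS]invrK invf_div lef_pV2 ?posrE//.
  apply: (@le_trans _ _ (Num.truncn (2 / e)).+1%:R); last by rewrite ler_nat.
  by case/andP: (truncn_itv (ltW e20)) => _ /ltW.
exists (fun k => (a < k%:R / N%:R <= b)).
apply: (@le_trans _ _ (lam (`]a, a + N%:R^-1] `|` `]b, b + N%:R^-1]))).
  apply: le_lam => x.
  have H : I01 x -> (Num.truncn (N%:R * x))%:R / N%:R <= x <
                    (Num.truncn (N%:R * x))%:R / N%:R + N%:R^-1.
    rewrite /= in_itv /= => /andP[x0 _].
    have Nx0 : 0 <= N%:R * x by apply: mulr_ge0 => //; exact: ltW.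
    have /andP[t1 t2] := truncn_itv Nx0.
    rewrite ler_pdivrMr// [x * _]mulrC t1 /=.
    rewrite -[X in _ + X]mul1r -mulrDl natr1.
    by rewrite ltr_pdivlMr// [x * _]mulrC.
  move: H; set k := _ / _ => H.
  rewrite /sdiff /grid /= => -[[[xab /[dup] Ix /H /andP[kx xk]] nk]|].
    move: xab; rewrite !in_itv /= => /andP[ax xb].
    left; rewrite ax /=.
    have [ak|ka] := ltP a k; last by apply: ltW; apply: lt_le_trans xk _; rewrite lerD2r.
    by case: nk; split=> //; rewrite ak (le_trans kx).
  move=> [[/[dup] Ix /H /andP[kx xk] /andP[ak kb]]] nx.
  rewrite !in_itv /=; right; rewrite ltNge; apply/andP; split; last first.
    by apply: ltW; apply: lt_le_trans xk _; rewrite lerD2r.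
  by apply: contra_notN nx => xb; split=> //; rewrite in_itv /= xb (lt_le_trans ak).
have l c : lam `]c, c + N%:R^-1] = (N%:R^-1)%:E.
  by rewrite lam_itv /= lte_fin ltrDl invr_gt0 N0 -EFinB addrAC subrr add0r.
apply: le_trans (lamU2 _ _) _.
by rewrite [e]splitr EFinD; apply: leeD; rewrite l lee_fin.
Qed.

Lemma grid_approxP A : lmeas A -> A `<=` I01 -> grid_approx A.
Proof.
move=> mA AI e e0; have e30 : 0 < e / 3 by rewrite divr_gt0.
have lA : lam A \is a fin_num.
  rewrite ge0_fin_numE ?lam_ge0//.
  apply: le_lt_trans (le_lam AI) _.
  by rewrite lam_itv /= lte_fin ltr01 -EFinB ltry.
have [_ [F [mF AF] <-] ltF] := @lb_ereal_inf_adherent _ _ _ e30 lA.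
have lF k : lam (F k) = wlength idfun (F k) by exact: measurable_mu_extE.
have mcF k : lmeas (F k) by apply: caratheodory_measurable_mu_ext; exact: mF.
have F0 k : (0 <= lam (F k))%E by exact: lam_ge0.
have sumF : (\sum_(0 <= k <oo) lam (F k) < lam A + (e / 3)%:E)%E.
  by rewrite (eq_eseriesr (fun k _ => lF k)).
have sumoo : (\sum_(0 <= k <oo) lam (F k) < +oo)%E.
  by apply: lt_le_trans sumF _; rewrite leey.
have := nneseries_tail_cvg sumoo (fun k _ => F0 k).
move=> /fine_cvgP[fT] /cvgrPdist_lt /(_ _ e30) cT.
have [K [/= KT1 KT2]] : exists K, (\sum_(K <= k <oo) lam (F k))%E \is a fin_num
    /\ (\sum_(K <= k <oo) lam (F k) < (e / 3)%:E)%E.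
  have [K _ HK] : \forall n \near \oo, (\sum_(n <= k <oo) lam (F k))%E
     \is a fin_num /\ `|0 - fine (\sum_(n <= k <oo) lam (F k))%E| < e / 3.
    by near=> n; split; near: n.
  have [f1 f2] := HK K (leqnn K); exists K; split=> //.
  rewrite -(fineK f1) lte_fin; apply: le_lt_trans f2.
  by rewrite sub0r normrN ler_norm.
pose U := \big[setU/set0]_(k < K) F k.
have [M MP] : exists M, forall N, (M <= N)%N ->
    exists P, (lam (sdiff (U `&` I01) (grid N P)) <= (e / 3)%:E)%E.
  suff : grid_approx U by apply.
  rewrite /U; elim/big_ind: _ => [||k _]; [exact: grid_approx0|exact: grid_approxU|].
  by case: (mF k) => -[a b] _ <-; exact: grid_approx_itv.
exists M => N /MP[P PU]; exists P.
have UF : U `<=` \bigcup_k F k.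
  by rewrite /U -(bigcup_mkord _ F) => x [k _ Fk]; exists k.
have mUF : lmeas (\bigcup_k F k) by exact: bigcupT_measurable.
have lD : (lam (\bigcup_k F k `\` A) <= (e / 3)%:E)%E.
  have -> : lam (\bigcup_k F k `\` A) = (lam (\bigcup_k F k) - lam A)%E.
    rewrite measureD//; last first.
      apply: le_lt_trans (sumoo).
      exact: lam_bigcup.
    by congr (_ - lam _)%E; rewrite setIC; apply/setIidPl.
  rewrite leeBlDl//; apply: le_trans (ltW sumF).
  exact: lam_bigcup.
apply: (@le_trans _ _ (lam ((sdiff (U `&` I01) (grid N P) `|`
   (\bigcup_k F k `\` A)) `|` \bigcup_(k in ~` `I_K) F k))).
  apply: le_lam => x.
  have [Gx|nGx] := pselect (grid N P x).
    have [Ax|nAx] := pselect (A x).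
      by case=> [[_ /(_ Gx)]//|[_ []]]; split=> //; case: Gx.
    case=> -[] // _ _; left.
    have [Ux|nUx] := pselect ((U `&` I01) x); last by left; right.
    by right; split=> //; apply: UF; case: Ux.
  case=> -[] // [Ax Ix] _.
  have [Ux|nUx] := pselect (U x); first by left; left; left; split.
  right; have [k _ Fk] := AF _ Ax; exists k => //.
  move=> /= kK; apply: nUx; rewrite /U -(bigcup_mkord _ F); by exists k.
have -> : e = e / 3 + e / 3 + e / 3 by field.
apply: le_trans (lamU2 _ _) _; rewrite EFinD; apply: leeD.
  by apply: le_trans (lamU2 _ _) _; rewrite EFinD; apply: leeD.
apply: le_trans (ltW KT2).
exact: lam_bigcup_tail.
Unshelve. all: by end_near. Qed.

End GridApproximation.

(* The carrier is the whole of [R], with every set off [[0, 1)] declared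
   negligible: this keeps the restricted measure complete. *)
Definition unit_type (R : realType) : Type := R.
Definition unit_display : measure_display. Proof. exact. Qed.

Section UnitSpace.
Variable R : realType.

Local Notation lam := (@completed_lebesgue_measure R).
Local Notation lmeas := (@lebesgue_measurable R).
Local Notation I01 := (`[0, 1[%classic : set R).

Definition unit_measurable : set (set (unit_type R)) :=
  [set A | lmeas (A `&` I01)].

Let unit_measurable0 : unit_measurable set0.
Proof. by rewrite /unit_measurable /= set0I; exact: measurable0. Qed.

Let unit_measurableC A : unit_measurable A -> unit_measurable (~` A).
Proof.
move=> mA; rewrite /unit_measurable /=.
have -> : ~` A `&` I01 = I01 `\` (A `&` I01) by rewrite setDIr setDv setU0 setIC setDE.
by apply: measurableD => //; exact: lmeas_itv.
Qed.

Let unit_measurable_bigcup (F : (set (unit_type R))^nat) :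
  (forall i, unit_measurable (F i)) -> unit_measurable (\bigcup_i F i).
Proof.
move=> mF; rewrite /unit_measurable /= setI_bigcupl.
exact: bigcupT_measurable.
Qed.

HB.instance Definition _ := Pointed.copy (unit_type R) R.
HB.instance Definition _ := @isMeasurable.Build unit_display (unit_type R)
  unit_measurable unit_measurable0 unit_measurableC unit_measurable_bigcup.

Definition unit_prob (A : set (unit_type R)) : \bar R := lam (A `&` I01).

Let unit_prob0 : unit_prob set0 = 0%E.
Proof. by rewrite /unit_prob set0I measure0. Qed.

Let unit_prob_ge0 A : (0 <= unit_prob A)%E.
Proof. exact: lam_ge0. Qed.

Let unit_prob_sigma_additive : semi_sigma_additive unit_prob.
Proof.
move=> F mF tF mU; rewrite /unit_prob setI_bigcupl.
apply: measure_sigma_additive => //.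
apply/trivIsetP => i j _ _ ij.
move/trivIsetP : tF => /(_ i j Logic.I Logic.I ij).
by rewrite setIACA => ->; rewrite set0I.
Qed.

HB.instance Definition _ := isMeasure.Build _ _ _ unit_prob
  unit_prob0 unit_prob_ge0 unit_prob_sigma_additive.

Lemma lam_I01 : lam I01 = 1%E.
Proof. by rewrite lam_itv /= lte_fin ltr01 -EFinB subr0. Qed.

Let unit_probT : unit_prob setT = 1%E.
Proof. by rewrite /unit_prob setTI lam_I01. Qed.

HB.instance Definition _ :=
  Measure_isProbability.Build _ _ _ unit_prob unit_probT.

Lemma unit_prob_lebesgue : nonatomic_lebesgue_space unit_prob.
Proof.
split.
  move=> N [B [mB B0 NB]]; apply: completed_lebesgue_measure_is_complete.
  by exists (B `&` I01); split=> //; exact: setSI.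
exists I01, I01, idfun; split.
- split; last by rewrite /= /unit_prob setIid lam_I01.
  by rewrite /measurable /= /unit_measurable /= setIid; exact: lmeas_itv.
- split; [|exact: lmeas_itv|exact: lam_I01].
  by move=> x /=; rewrite !in_itv /= => /andP[-> /ltW].
- split => [x //|x y _ _ //|x Ix]; by exists x.
- move=> A AI; rewrite image_id; split.
    by rewrite /measurable /= /unit_measurable /= setIidl.
  by rewrite /measurable /= /unit_measurable /= setIidl.
- by move=> A AI mA; rewrite image_id /= /unit_prob setIidl.
Qed.

End UnitSpace.


(** * Rigidity in mean square from rigidity on sets *)

Import HBSimple HBNNSimple.

Section RigidityFromSets.
Context (R : realType) (d : measure_display) (X : measurableType d)
  (mu : probability X R) (T : nat -> X -> X).
Hypothesis mT : forall n, measurable_fun setT (T n).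
Hypothesis muT : forall n A, measurable A -> mu (T n @^-1` A) = mu A.
Implicit Types (f g h : X -> R).

Let norm2 (h : X -> R) : \bar R := 'N[mu]_2%:E[EFin \o h]%E.

Lemma norm2E h : norm2 h = ((\int[mu]_x ((h x) ^+ 2)%:E) `^ 2^-1)%E.
Proof.
rewrite /norm2 unlock /Lnorm; congr (_ `^ _)%E.
by apply: eq_integral => x _ /=; rewrite powR_mulrn// real_normK ?num_real.
Qed.

Lemma norm2_le h (e : R) : 0 <= e ->
  (\int[mu]_x ((h x) ^+ 2)%:E <= (e ^+ 2)%:E)%E -> (norm2 h <= e%:E)%E.
Proof.
move=> e0 he; rewrite norm2E.
have -> : e%:E = ((e ^+ 2)%:E `^ 2^-1)%E.
  by rewrite poweR_EFin -powR_mulrn// -powRrM mulfV// powRr1.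
apply: gt0_ler_poweR => //; rewrite in_itv /= leey andbT.
  by apply: integral_ge0 => x _; rewrite lee_fin sqr_ge0.
by rewrite lee_fin sqr_ge0.
Qed.

Definition asymp_inv f := measurable_fun setT f /\
  forall e, 0 < e -> \forall n \near \oo, (norm2 (fun x => f (T n x) - f x)%R <= e%:E)%E.

Lemma norm2_triangle f g : measurable_fun setT f -> measurable_fun setT g ->
  (norm2 (fun x => (f x + g x)%R) <= norm2 f + norm2 g)%E.
Proof. by move=> mf mg; apply: (minkowski_EFin mu mf mg); rewrite ler1n. Qed.

Lemma norm2N f : norm2 (fun x => - f x) = norm2 f.
Proof. by rewrite !norm2E; congr (_ `^ _)%E; apply: eq_integral => x _; rewrite sqrrN. Qed.

Lemma norm2_comp f n : measurable_fun setT f ->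
  norm2 (fun x => f (T n x)) = norm2 f.
Proof.
move=> mf; rewrite !norm2E; congr (_ `^ _)%E.
transitivity (\int[pushforward mu (T n)]_y ((f y ^+ 2)%:E))%E.
  rewrite ge0_integral_pushforward//.
  - by apply/measurable_EFinP; exact: measurable_funX.
  - by move=> y _; rewrite lee_fin sqr_ge0.
by apply: eq_measure_integral => A mA _; exact: muT.
Qed.

Lemma measurable_diff f n : measurable_fun setT f ->
  measurable_fun setT (fun x => f (T n x) - f x).
Proof.
by move=> mf; apply: measurable_funB => //; exact: measurableT_comp.
Qed.

Lemma asymp_invD f g : asymp_inv f -> asymp_inv g ->
  asymp_inv (fun x => f x + g x).
Proof.
move=> [mf cf] [mg cg]; split; first exact: measurable_funD.
move=> e e0; have e20 : 0 < e / 2 by rewrite divr_gt0.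
near=> n; rewrite [e in e%:E]splitr EFinD.
rewrite (_ : (fun x => _) =
    fun x => (f (T n x) - f x) + (g (T n x) - g x)); last first.
  by apply/funext => x; rewrite opprD addrACA.
apply: le_trans (norm2_triangle _ _) (leeD _ _); try exact: measurable_diff.
- by near: n; exact: cf.
- by near: n; exact: cg.
Unshelve. all: by end_near. Qed.

Lemma asymp_inv_density f : measurable_fun setT f ->
  (forall e, 0 < e -> exists2 g, asymp_inv g &
    (norm2 (fun x => f x - g x)%R <= e%:E)%E) -> asymp_inv f.
Proof.
move=> mf fg; split=> // e e0; have e30 : 0 < e / 3 by rewrite divr_gt0.
have [g [mg cg] fge] := fg _ e30.
have mfg : measurable_fun setT (fun x => f x - g x) by exact: measurable_funB.
near=> n.
rewrite (_ : (fun x => _) = fun x => ((f (T n x) - g (T n x)) +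
    (g (T n x) - g x)) + - (f x - g x)); last first.
  by apply/funext => x; ring.
have -> : e = e / 3 + e / 3 + e / 3 by field.
rewrite !EFinD; apply: le_trans (norm2_triangle _ _) (leeD _ _).
- apply: measurable_funD; last exact: measurable_diff.
  exact: (measurableT_comp mfg (mT n)).
- exact: measurableT_comp.
- apply: le_trans (norm2_triangle _ _) (leeD _ _).
  + exact: (measurableT_comp mfg (mT n)).
  + exact: measurable_diff.
  + by rewrite (norm2_comp n mfg).
  + by near: n; exact: cg.
- by rewrite norm2N.
Unshelve. all: by end_near. Qed.

Hypothesis muTA : forall A, measurable A ->
  mu (T n @^-1` A `\` A) @[n --> \oo] --> 0%E.

Lemma asymp_inv_indic (c : R) (A : set X) : measurable A ->
  asymp_inv (fun x => c * \1_A x).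
Proof.
move=> mA; split; first by apply: measurable_funM.
move=> e e0.
have [-> | c0] := eqVneq c 0.
  near=> n; apply: norm2_le; first exact: ltW.
  by rewrite integral0_eq ?lee_fin ?sqr_ge0// => x _; rewrite !mul0r subrr expr0n.
have mTA n : measurable (T n @^-1` A) by rewrite -[_ @^-1` _]setTI; exact: mT.
have mD n : mu (A `\` T n @^-1` A) = mu (T n @^-1` A `\` A).
  rewrite !measureD ?ltey_eq ?fin_num_measure// setIC.
  by congr (_ - _)%E; exact/esym/muT.
pose de := e ^+ 2 / (c ^+ 2) / 2.
have c20 : 0 < c ^+ 2 by rewrite exprn_even_gt0.
have de0 : 0 < de by rewrite !divr_gt0// exprn_gt0.
have /fine_cvgP[_ /cvgrPdist_le /(_ _ de0) cA] := muTA mA.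
near=> n; apply: norm2_le; first exact: ltW.
have fine_small : (mu (T n @^-1` A `\` A) <= de%:E)%E.
  rewrite -[leLHS]fineK ?fin_num_measure//; last exact: measurableD.
  rewrite lee_fin; apply: le_trans (ler_norm _) _.
  by rewrite -normrN -sub0r; near: n; exact: cA.
have -> : (\int[mu]_x ((c * \1_A (T n x) - c * \1_A x) ^+ 2)%:E =
   \int[mu]_x ((c ^+ 2)%:E * (\1_((T n @^-1` A `\` A) `|` (A `\` T n @^-1` A)) x)%:E))%E.
  apply: eq_integral => x _; rewrite -EFinM; congr EFin.
  rewrite -mulrBr exprMn; congr (_ * _); rewrite !indicE in_setU !in_setD.
  rewrite (_ : (x \in T n @^-1` A) = (T n x \in A)); last first.
    by apply/idP/idP; rewrite !inE.
  by case: (T n x \in A); case: (x \in A) => /=; ring.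
rewrite ge0_integralZl//; last 2 first.
- apply/measurable_EFinP; apply: measurable_indic.
  by apply: measurableU; exact: measurableD.
- by rewrite lee_fin sqr_ge0.
rewrite integral_indic//; last by apply: measurableU; exact: measurableD.
rewrite setIT.
apply: (@le_trans _ _ ((c ^+ 2)%:E * (de%:E + de%:E)))%E.
  apply: lee_wpmul2l; first by rewrite lee_fin sqr_ge0.
  apply: le_trans (measureU2 _ _ _) (leeD _ _) => //; try exact: measurableD.
  by move: fine_small; rewrite -mD.
rewrite -EFinD -EFinM lee_fin /de -splitr mulrC divfK// expf_neq0//.
Unshelve. all: by end_near. Qed.

Lemma asymp_inv_sum n (c : 'I_n -> R) (A : 'I_n -> set X) :
  (forall i, measurable (A i)) ->
  asymp_inv (fun x => \sum_(i < n) c i * \1_(A i) x).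
Proof.
elim: n c A => [|n IHn] c A mA.
  have := asymp_inv_indic 0 (@measurable0 _ X); congr asymp_inv.
  by apply/funext => x; rewrite big_ord0 mul0r.
under eq_fun do rewrite big_ord_recr /=.
by apply: asymp_invD; [exact: IHn|exact: asymp_inv_indic].
Qed.

Lemma asymp_invN f : asymp_inv f -> asymp_inv (fun x => - f x).
Proof.
move=> [mf cf]; split; first exact: measurableT_comp.
move=> e /cf; apply: filterS => n; congr (is_true (_ <= _)%E).
by rewrite -norm2N; congr norm2; apply/funext => x; rewrite opprD.
Qed.

Lemma asymp_inv_ge0 f : f \in Lfun mu 2%:E -> (forall x, 0 <= f x) -> asymp_inv f.
Proof.
move=> /[dup] f2 /Lfun2_integrable_sqr if2 f0.
have mf : measurable_fun setT f by move: f2; rewrite inE => /andP[/[!inE]].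
have mEf : measurable_fun setT (EFin \o f) by exact/measurable_EFinP.
apply: asymp_inv_density => // e e0.
pose g := nnsfun_approx measurableT mEf.
have g0 n x : 0 <= g n x by [].
have gle n x : g n x <= f x.
  by rewrite /g nnsfun_approxE -lee_fin; apply: le_approx => // y _; rewrite lee_fin.
have mfg n : measurable_fun setT (fun x => f x - g n x).
  by apply: measurable_funB => //.
have [] := @dominated_convergence _ _ _ mu setT measurableT
    (fun n x => ((f x - g n x) ^+ 2)%:E) (cst 0%E) (fun x => (f x ^+ 2)%:E).
- by move=> n; apply/measurable_EFinP; exact: measurable_funX.
- exact: measurable_cst.
- apply: aeW => x _.
  have cg : (g n x @[n --> \oo]) --> f x.
    have := @cvg_nnsfun_approx _ _ _ setT measurableT _ mEf
      (fun y _ => _) x I; rewrite /=.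
    by move=> /(_ (fun y => f0 y)) /fine_cvgP[].
  have -> : cst 0%E x = ((f x - f x) ^+ 2)%:E :> \bar R.
    by rewrite subrr expr0n.
  apply: cvg_EFin; first by near=> n.
  under eq_fun do rewrite /= expr2; rewrite expr2.
  by apply: cvgM; apply: cvgB => //; exact: cvg_cst.
- exact: if2.
- apply: aeW => x n _; rewrite /= ger0_norm ?sqr_ge0// lee_fin.
  rewrite ler_pXn2r ?nnegrE ?subr_ge0//.
  by rewrite gerDl oppr_le0.
move=> _ _; rewrite integral0 => /fine_cvgP[fT] /cvgrPdist_le.
have e20 : 0 < e ^+ 2 by rewrite exprn_gt0.
move=> /(_ _ e20) HN.
near \oo => N; exists (g N); last first.
  apply: norm2_le; first exact: ltW.
  have fTN : (\int[mu]_x ((f x - g N x) ^+ 2)%:E)%E \is a fin_num by near: N.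
  rewrite -[leLHS]fineK// lee_fin; apply: le_trans (ler_norm _) _.
  by rewrite -normrN -sub0r; near: N.
rewrite (funext (fimfunEord (g N))).
by apply: asymp_inv_sum => i; exact: measurable_sfunP.
Unshelve. all: by end_near. Qed.

Lemma asymp_invP f : f \in Lfun mu 2%:E -> asymp_inv f.
Proof.
move=> f2; have mf : measurable_fun setT f by move: f2; rewrite inE => /andP[/[!inE]].
have L2 g : measurable_fun setT g -> (forall x, `|g x| <= `|f x|) ->
    g \in Lfun mu 2%:E.
  move=> mg gf; rewrite inE; apply/andP; split; rewrite inE //=.
  have : (norm2 f < +oo)%E by move: f2; rewrite inE => /andP[_ /[!inE]].
  apply: le_lt_trans.
  rewrite -/(norm2 g) !norm2E; apply: gt0_ler_poweR => //;
    try by rewrite in_itv /= leey andbT integral_ge0// => x _; rewrite lee_fin sqr_ge0.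
  apply: ge0_le_integral => //.
  - by move=> x _; rewrite lee_fin sqr_ge0.
  - by apply/measurable_EFinP; exact: measurable_funX.
  - by apply/measurable_EFinP; exact: measurable_funX.
  - move=> x _; rewrite lee_fin -(real_normK (num_real (g x))).
    by rewrite -(real_normK (num_real (f x))) ler_pXn2r ?nnegrE.
have -> : f = fun x => Num.max (f x) 0 + - Num.max (- f x) 0.
  apply/funext => x; rewrite -[X in - Num.max _ X]oppr0 -oppr_min opprK.
  by rewrite addr_max_min addr0.
apply: asymp_invD; last apply: asymp_invN.
  apply: asymp_inv_ge0; last by move=> x; rewrite le_max lexx orbT.
  apply: L2 => [|x]; first exact: measurable_maxr.
  by rewrite maxEle; case: ifP; rewrite ?normr0.
apply: asymp_inv_ge0; last by move=> x; rewrite le_max lexx orbT.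
apply: L2 => [|x]; first by apply: measurable_maxr => //; exact: measurableT_comp.
by rewrite maxEle; case: ifP; rewrite ?normr0 ?normrN.
Qed.

Lemma rigid_of_sets f : f \in Lfun mu 2%:E ->
  ('N[mu]_2%:E[EFin \o (fun x => f (T n x) - f x)%R])%E @[n --> \oo] --> 0%E.
Proof.
move=> /asymp_invP[mf cf]; apply/fine_cvgP; split.
  have := cf 1 ltr01; apply: filterS => n fn; rewrite ge0_fin_numE ?Lnorm_ge0//.
  by apply: le_lt_trans fn _; rewrite ltry.
apply/cvgrPdist_le => e e0; near=> n.
have fn : (norm2 (fun x => f (T n x) - f x)%R <= e%:E)%E.
  by near: n; exact: cf.
rewrite sub0r normrN ger0_norm; last by rewrite fine_ge0// Lnorm_ge0.
rewrite -lee_fin fineK// ge0_fin_numE ?Lnorm_ge0//.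
by apply: le_lt_trans fn _; rewrite ltry.
Unshelve. all: by end_near. Qed.

End RigidityFromSets.

(** * The tower of finite systems *)

Section Mean.
Variable R : numFieldType.

Definition mean (T : finType) (f : T -> R) : R :=
  #|T|%:R^-1 * \sum_(x : T) f x.

Lemma eq_mean (T : finType) (f g : T -> R) : f =1 g -> mean f = mean g.
Proof. by move=> fg; congr (_ * _); apply: eq_bigr => x _. Qed.

Lemma mean_cst (T : finType) (x0 : T) (c : R) : mean (fun _ : T => c) = c.
Proof.
rewrite /mean sumr_const -[c *+ _]mulr_natl mulKf// pnatr_eq0 -lt0n.
by apply/card_gt0P; exists x0.
Qed.

Lemma mean_bij (T : finType) (s : T -> T) (f : T -> R) : injective s ->
  mean (f \o s) = mean f.
Proof. by move=> s_inj; congr (_ * _); rewrite [RHS](reindex_inj s_inj). Qed.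

Lemma mean_pair (S T : finType) (f : S * T -> R) :
  mean f = mean (fun x => mean (fun y => f (x, y))).
Proof.
rewrite /mean card_prod natrM invfM -mulrA; congr (_ * _).
rewrite -mulr_sumr; congr (_ * _); rewrite pair_bigA /=.
by apply: eq_bigr => -[].
Qed.

Lemma mean_indic (T : finType) (P : pred T) :
  mean (fun x => (P x)%:R) = #|P|%:R / #|T|%:R.
Proof.
rewrite /mean mulrC; congr (_ / _); rewrite -sum1_card [in RHS]big_mkcond natr_sum.
by apply: eq_bigr => x _; rewrite unfold_in; case: (P x).
Qed.

Lemma mean_ffun2 (K S : finType) (c c' : K) (h : S -> S -> R) : c != c' ->
  mean (fun z : {ffun K -> S} => h (z c) (z c')) =
  mean (fun x => mean (fun y => h x y)).
Proof.
move=> cc'; have c'c : c' != c by rewrite eq_sym.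
have [S0|/card_gt0P[s0 _]] := posnP #|S|.
  rewrite /mean card_ffun S0 exp0n; last by apply/card_gt0P; exists c.
  by rewrite invr0 !mul0r.
have Sn0 : #|S|%:R != 0 :> R.
  by rewrite pnatr_eq0 -lt0n; apply/card_gt0P; exists s0.
have count a b : \sum_(z : {ffun K -> S}) ((z c == a) && (z c' == b))%:R
    = #|S|%:R ^+ (#|K| - 2) :> R.
  pose G i j : R := if i == c then (j == a)%:R else
                    if i == c' then (j == b)%:R else 1.
  transitivity (\sum_(z : {ffun K -> S}) \prod_i G i (z i)).
    apply: eq_bigr => z _.
    rewrite (bigD1 c) //= (bigD1 c') //= big1 => [|i /andP[ic ic']].
      by rewrite /G eqxx (negbTE c'c) eqxx mulr1 -natrM mulnb.
    by rewrite /G (negbTE ic) (negbTE ic').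
  rewrite -bigA_distr_bigA /= (bigD1 c) //= (bigD1 c') //=.
  rewrite [X in _ * (_ * X)](eq_bigr (fun=> #|S|%:R)) => [|i /andP[ic ic']]; last first.
    by rewrite /G (negbTE ic) (negbTE ic') sumr_const.
  have sum1 s : \sum_j (j == s)%:R = 1 :> R.
    by rewrite (bigD1 s) //= eqxx big1 ?addr0// => j /negbTE->.
  rewrite /G eqxx (negbTE c'c) eqxx !sum1 !mul1r prodr_const.
  congr (_ ^+ _); rewrite [in RHS](cardD1 c) [in RHS](cardD1 c') !inE c'c /=.
  rewrite addnA addKn; apply: eq_card => i.
  by rewrite !inE andbT andbC.
have -> : mean (fun z : {ffun K -> S} => h (z c) (z c')) =
    #|S|%:R ^- #|K| * \sum_a \sum_b h a b * #|S|%:R ^+ (#|K| - 2).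
  rewrite /mean card_ffun natrX; congr (_ * _).
  transitivity (\sum_(z : {ffun K -> S}) \sum_a \sum_b
       h a b * ((z c == a) && (z c' == b))%:R).
    apply: eq_bigr => z _; rewrite (bigD1 (z c)) //= (bigD1 (z c')) //= !eqxx.
    rewrite mulr1 !big1 ?addr0// => [a az|b bz]; first last.
      by rewrite [z c' == b]eq_sym (negbTE bz) mulr0.
    by apply: big1 => b _; rewrite [z c == a]eq_sym (negbTE az) mulr0.
  rewrite exchange_big; apply: eq_bigr => a _.
  rewrite exchange_big; apply: eq_bigr => b _.
  by rewrite -mulr_sumr count.
have K2 : (2 <= #|K|)%N.
  by rewrite (cardD1 c) (cardD1 c') !inE c'c.
under eq_bigr do rewrite -mulr_suml.
rewrite -mulr_suml /mean -mulr_sumr -{1}(subnK K2) exprD.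
have := expf_neq0 (#|K| - 2) Sn0.
move: (_ ^+ (#|K| - 2)) (\sum_i _) => e s e0.
by field; rewrite Sn0 e0.
Qed.

End Mean.

Section Tower.
Variable F : finFieldType.
Implicit Types (m n j k : nat) (gam : nat -> F).

(* Each level is a union of free orbits of [F ^ m]; [fib m] indexes the orbits.
   An element of [fib m.+1] carries a switch, on with probability [1 / (m + 2)],
   and [#|F|] independent points of level [m]. *)
Fixpoint fib m : finType :=
  if m is k.+1 then
    ('I_k.+2 * {ffun F -> {ffun 'I_k -> F} * fib k})%type : finType
  else unit.
Definition state m : finType := ({ffun 'I_m -> F} * fib m)%type.

Definition shift m (d : {ffun 'I_m -> F}) (x : state m) : state m :=
  (d + x.1, x.2).

Definition vec m gam : {ffun 'I_m -> F} := [ffun i : 'I_m => gam i].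

Definition trunc_vec m (d : {ffun 'I_m.+1 -> F}) : {ffun 'I_m -> F} :=
  [ffun i => d (widen_ord (leqnSn m) i)].

(* While the switch is off, moving along the last coordinate is invisible on
   the level below; while it is on, it resamples the point. *)
Definition proj m (x : state m.+1) : state m :=
  shift (trunc_vec x.1) (x.2.2 (if x.2.1 == ord0 then x.1 ord_max else 0)).

Lemma shiftD m d e (x : state m) : shift (d + e) x = shift d (shift e x).
Proof. by rewrite /shift /= addrA. Qed.

Lemma shift0 m (x : state m) : shift 0 x = x.
Proof. by case: x => u i; rewrite /shift /= add0r. Qed.

Lemma shift_inj m (d : {ffun 'I_m -> F}) : injective (shift d).
Proof. by apply: (can_inj (g := shift (- d))) => x; rewrite -shiftD addNr shift0. Qed.

Lemma vecD m gam gam' : vec m (fun k => gam k + gam' k) = vec m gam + vec m gam'.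
Proof. by apply/ffunP => i; rewrite !ffunE. Qed.

Lemma trunc_vecD m (d e : {ffun 'I_m.+1 -> F}) :
  trunc_vec (d + e) = trunc_vec d + trunc_vec e.
Proof. by apply/ffunP => i; rewrite !ffunE. Qed.

Lemma trunc_vecE m gam : trunc_vec (vec m.+1 gam) = vec m gam.
Proof. by apply/ffunP => i; rewrite !ffunE. Qed.

Lemma proj_shift m (d : {ffun 'I_m.+1 -> F}) (x : state m.+1) :
  d ord_max = 0 -> proj (shift d x) = shift (trunc_vec d) (proj x).
Proof.
by move=> d0; rewrite /proj /= ffunE d0 add0r trunc_vecD shiftD.
Qed.

Lemma state_inh m : exists x : state m, True.
Proof.
elim: m => [|m [x _]]; first by exists (0, tt).
by exists (0, (ord0, [ffun=> x])).
Qed.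

Lemma card_state_gt0 m : (0 < #|state m|)%N.
Proof. by have [x _] := state_inh m; apply/card_gt0P; exists x. Qed.

Section StateMean.
Variable R : numFieldType.

Lemma mean_proj2 m (d : {ffun 'I_m.+1 -> F}) (h : state m -> state m -> R) :
  let p := (d ord_max != 0)%:R / m.+2%:R in
  mean (fun x => h (proj x) (proj (shift d x))) =
  (1 - p) * mean (fun x => h x (shift (trunc_vec d) x)) +
  p * mean (fun x => mean (fun y => h x y)).
Proof.
move=> p; pose d0 := trunc_vec d; set A := mean _; set B := mean _.
rewrite {}/A mean_pair.
suff E u : mean (fun y : fib m.+1 => h (proj (u, y)) (proj (shift d (u, y)))) =
    (1 - p) * B + p * mean (fun x => mean (fun y => h x y)).
  by rewrite (eq_mean E) (mean_cst (0 : {ffun 'I_m.+1 -> F})).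
pose u0 := trunc_vec u; pose c := u ord_max; pose e := d ord_max.
have [x0 _] := state_inh m.
rewrite (mean_pair (S := 'I_m.+2) (T := {ffun F -> state m})).
have same c1 : mean (fun z : {ffun F -> state m} =>
    h (shift u0 (z c1)) (shift (d0 + u0) (z c1))) = B.
  rewrite (mean_ffun2 (c' := c1 + 1) (fun x _ => h (shift u0 x) (shift (d0 + u0) x))).
    under eq_mean => x do rewrite (mean_cst x0) shiftD.
    exact: (mean_bij (fun x => h x (shift d0 x)) (@shift_inj m u0)).
  by rewrite -subr_eq0 opprD addNKr oppr_eq0 oner_eq0.
have diff c1 c2 : c1 != c2 -> mean (fun z : {ffun F -> state m} =>
    h (shift u0 (z c1)) (shift (d0 + u0) (z c2))) =
      mean (fun x => mean (fun y => h x y)).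
  move=> c12; rewrite (mean_ffun2 (fun x y => h (shift u0 x) (shift (d0 + u0) y)))//.
  under eq_mean => x do rewrite (mean_bij (fun y => h (shift u0 x) y) (@shift_inj m _)).
  exact: (mean_bij (fun x => mean (h x)) (@shift_inj m u0)).
set C := mean _ in diff *.
have key (s : 'I_m.+2) : mean (fun z : {ffun F -> state m} =>
    h (proj (u, (s, z))) (proj (shift d (u, (s, z))))) =
    if (s == ord0) && (e != 0) then C else B.
  rewrite /proj /= trunc_vecD ffunE -/e -/c -/u0 -/d0.
  have [_|s0] /= := eqVneq s ord0; last exact: same.
  have [->|e0] /= := eqVneq e 0; first by rewrite add0r; exact: same.
  apply: diff; rewrite -subr_eq0 opprD addrCA subrr addr0 oppr_eq0//.
rewrite (eq_mean key) /mean big_ord_recl /= card_ord /p -/e.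
rewrite (eq_bigr (fun=> B)) => [|i _]; last by [].
rewrite sumr_const card_ord -mulr_natl.
have n0 : m.+2%:R != 0 :> R by rewrite pnatr_eq0.
have -> : m.+2%:R = m.+1%:R + 1 :> R by rewrite natr1.
have n1 : m.+1%:R + 1 != 0 :> R by rewrite natr1.
by case: (e != 0) => /=; field.
Qed.

Lemma mean_proj m (f : state m -> R) : mean (fun x => f (proj x)) = mean f.
Proof.
rewrite (mean_proj2 0 (fun x _ => f x)) ffunE eqxx mul0r subr0 mul1r mul0r.
by rewrite addr0.
Qed.

Fixpoint proj_iter n j : state (j + n) -> state n :=
  if j is k.+1 then fun x => proj_iter (proj x : state (k + n)) else id.

Definition decor n j gam : R :=
  \prod_(n <= k < j + n) (1 - (gam k != 0)%:R / k.+2%:R).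

Lemma mean_proj_iter n j gam (h : state n -> state n -> R) :
  mean (fun x => h (proj_iter x) (proj_iter (shift (vec (j + n) gam) x))) =
  decor n j gam * mean (fun x => h x (shift (vec n gam) x)) +
  (1 - decor n j gam) * mean (fun x => mean (fun y => h x y)).
Proof.
elim: j => [|j IHj].
  by rewrite /decor big_geq// mul1r subrr mul0r addr0.
have uniform (f : state n -> R) : mean (fun x : state (j + n) => f (proj_iter x)) = mean f.
  elim: j {IHj} => //= j IHj.
  by rewrite (mean_proj (fun x : state (j + n) => f (proj_iter x))).
rewrite /= (mean_proj2 (vec (j.+1 + n) gam)
  (fun x y : state (j + n) => h (proj_iter x) (proj_iter y))).
rewrite trunc_vecE IHj ffunE /=.
under [X in _ + _ * X]eq_mean => x do rewrite (uniform (h (proj_iter x))).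
rewrite (uniform (fun x => mean (h x))) /decor addSn big_nat_recr ?leq_addl//=.
ring.
Qed.

End StateMean.
End Tower.

Section Code.
Variable F : finFieldType.
Implicit Types (m n j k : nat) (gam : nat -> F).

Definition pad m (d : {ffun 'I_m -> F}) : {ffun 'I_m.+1 -> F} :=
  [ffun i => if unlift ord_max i is Some j then d j else 0].

Lemma pad_max m (d : {ffun 'I_m -> F}) : pad d ord_max = 0.
Proof. by rewrite ffunE unlift_none. Qed.

Lemma pad_trunc m (d : {ffun 'I_m -> F}) : trunc_vec (pad d) = d.
Proof.
apply/ffunP => i; rewrite !ffunE.
have -> : widen_ord (leqnSn m) i = lift ord_max i.
  by apply/val_inj; rewrite /= /bump leqNgt ltn_ord.
by rewrite liftK.
Qed.

Lemma padD m (d e : {ffun 'I_m -> F}) : pad (d + e) = pad d + pad e.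
Proof.
by apply/ffunP => i; rewrite !ffunE; case: unlift => [j|]; rewrite ?ffunE ?addr0.
Qed.

Lemma pad_vec m gam : gam m = 0 -> pad (vec m gam) = vec m.+1 gam.
Proof.
move=> g0; apply/ffunP => i; rewrite !ffunE.
by case: unliftP => [j ->|->]; rewrite ?ffunE ?lift_max.
Qed.

Definition fiber m (y : state F m) : seq (state F m.+1) :=
  enum [pred x | proj x == y].

(* The fibres of [proj] are numbered over the points with zero angle, then the
   numbering is transported along the free action, so it is invariant. *)
Definition rank m (x : state F m.+1) : nat :=
  index (shift (pad (- (proj x).1)) x) (fiber (0, (proj x).2)).

Definition width m : nat := #|state F m.+1| %/ #|state F m|.

Lemma card_fiber m (y : state F m) : #|[pred x | proj x == y]| = width m.
Proof.
have := @mean_proj F rat m (fun x => (x == y)%:R).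
rewrite (mean_indic rat (fun x => proj x == y)) (mean_indic rat (pred1 y)) card1.
have [c1 c2] := (card_state_gt0 F m, card_state_gt0 F m.+1).
move/eqP; rewrite eqr_div ?pnatr_eq0 -?lt0n// -!natrM eqr_nat mul1n => /eqP E.
by rewrite /width -E mulnK.
Qed.

Lemma width_gt0 m : (0 < width m)%N.
Proof.
have [x _] := state_inh F m.+1.
by rewrite -(card_fiber (proj x)); apply/card_gt0P; exists x; rewrite inE.
Qed.

Lemma card_stateS m : #|state F m.+1| = (#|state F m| * width m)%N.
Proof.
rewrite -[LHS]sum1_card (partition_big (@proj F m) xpredT) //=.
rewrite (eq_bigr (fun=> width m)) => [|y _]; last first.
  by rewrite -(card_fiber y) -sum1_card; apply: eq_bigl.
by rewrite sum_nat_const.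
Qed.

Lemma proj_base m (x : state F m.+1) :
  proj (shift (pad (- (proj x).1)) x) = (0, (proj x).2).
Proof. by rewrite proj_shift ?pad_max// pad_trunc /shift addNr. Qed.

Lemma rank_shift m (d : {ffun 'I_m -> F}) x : rank (shift (pad d) x) = rank x.
Proof.
rewrite /rank proj_shift ?pad_max// pad_trunc /= -shiftD -padD opprD addrC addNKr.
by [].
Qed.

Lemma rank_inj m (x y : state F m.+1) : proj x = proj y -> rank x = rank y -> x = y.
Proof.
rewrite /rank => pxy; rewrite pxy => E.
apply: (@shift_inj _ _ (pad (- (proj y).1))).
move/index_inj: E; apply; first exact: y.
  by rewrite /fiber mem_enum inE -pxy proj_base.
by rewrite /fiber mem_enum inE proj_base.
Qed.

Lemma rank_lt m (x : state F m.+1) : (rank x < width m)%N.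
Proof.
rewrite -(card_fiber (0, (proj x).2)) cardE index_mem mem_enum inE.
by rewrite proj_base.
Qed.

Fixpoint code m : state F m -> nat :=
  if m is k.+1 then fun x => (code (proj x) * width k + rank x)%N else fun=> 0%N.

Lemma code_proj m (x : state F m.+1) : (code x %/ width m)%N = code (proj x).
Proof. by rewrite /= divnMDl ?width_gt0// divn_small ?addn0// rank_lt. Qed.

Lemma code_lt m (x : state F m) : (code x < #|state F m|)%N.
Proof.
elim: m x => [|m IHm] x; first by rewrite card_state_gt0.
by rewrite card_stateS -ltn_divLR ?width_gt0// code_proj.
Qed.

Lemma code_inj m : injective (@code m).
Proof.
elim: m => [|m IHm] x y.
  by case: x y => u [] [v []] _; congr pair; apply/ffunP => -[].
move=> E; have p : proj x = proj y by apply: IHm; rewrite -!code_proj E.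
by apply: rank_inj => //; move: E; rewrite /= p => /addnI.
Qed.

Lemma code_onto m k : (k < #|state F m|)%N -> exists x : state F m, code x = k.
Proof.
move=> km; pose f (x : state F m) := Ordinal (code_lt x).
have f_inj : injective f by move=> x y /(congr1 val) /code_inj.
have [|g fg gf] := inj_card_bij f_inj; first by rewrite card_ord.
by exists (g (Ordinal km)); have /(congr1 val) := gf (Ordinal km).
Qed.

Lemma code_shiftS m gam (x : state F m.+1) : gam m = 0 ->
  (code (shift (vec m.+1 gam) x) = code (shift (vec m gam) (proj x)) * width m + rank x)%N.
Proof.
by move=> g0; rewrite -pad_vec //= rank_shift proj_shift ?pad_max// pad_trunc.
Qed.

Lemma card_state_ge m : (2 ^ m <= #|state F m|)%N.
Proof.
rewrite card_prod card_ffun card_ord; apply: leq_trans (leq_pmulr _ _).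
  by case: m => // m; rewrite leq_exp2r// finNzRing_gt1.
by have [[u i] _] := state_inh F m; apply/card_gt0P; exists i.
Qed.

End Code.


(** * The limit action on [0, 1) *)

Section Action.
Variables (R : realType) (F : finFieldType).
Implicit Types (m n j k : nat) (gam : nat -> F) (xi : R).

Local Notation I01 := (`[0, 1[%classic : set R).
Local Notation N m := (#|state F m|%:R : R).
Local Notation mu := (@unit_prob R).

Lemma N_gt0 m : 0 < N m.
Proof. by rewrite ltr0n card_state_gt0. Qed.

Definition pos m xi : state F m :=
  xget (sval (cid (state_inh F m)))
       [set x | code x = Num.truncn (N m * xi)].

Lemma code_pos m xi : I01 xi -> code (pos m xi) = Num.truncn (N m * xi).
Proof.
rewrite /= in_itv /= => /andP[x0 x1].
have [|x xE] := @code_onto F m (Num.truncn (N m * xi)).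
  rewrite truncn_lt_nat ?mulr_ge0// -[ltRHS]mulr1 ltr_pM2l ?N_gt0//.
exact: (@xgetPex _ _ [set x | code x = Num.truncn (N m * xi)]
  (ex_intro _ x xE)).
Qed.

Lemma code_itv m xi : I01 xi ->
  (code (pos m xi))%:R <= N m * xi < (code (pos m xi)).+1%:R.
Proof.
move=> Ix; rewrite code_pos//; apply: truncn_itv.
by move: Ix; rewrite /= in_itv /= => /andP[x0 x1]; rewrite mulr_ge0.
Qed.

Lemma pos_eq m xi (x : state F m) : I01 xi ->
  (code x)%:R <= N m * xi < (code x).+1%:R -> pos m xi = x.
Proof. by move=> Ix /truncn_def E; apply: code_inj; rewrite code_pos. Qed.

Lemma pos_proj m xi : I01 xi -> proj (pos m.+1 xi) = pos m xi.
Proof.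
move=> Ix; apply/esym/pos_eq => //; rewrite -code_proj.
have w0 : 0 < (width F m)%:R :> R by rewrite ltr0n width_gt0.
have /andP[c1 c2] := code_itv m.+1 Ix; set c := code (pos m.+1 xi) in c1 c2 *.
rewrite card_stateS natrM mulrAC in c1 c2.
rewrite -(ler_pM2r w0) -(ltr_pM2r w0) -!natrM; apply/andP; split.
  by apply: le_trans c1; rewrite ler_nat leq_divM.
by apply: lt_le_trans c2 _; rewrite ler_nat ltn_ceil// width_gt0.
Qed.

Definition offset m gam (x : state F m) : R :=
  ((code (shift (vec m gam) x))%:R - (code x)%:R) / N m.

Definition act m gam : unit_type R -> unit_type R := fun xi : R =>
  if xi \in I01 then xi + offset gam (pos m xi) else xi.

Lemma act_in m gam xi : I01 xi -> act m gam xi = xi + offset gam (pos m xi).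
Proof. by move=> Ix; rewrite /act mem_set. Qed.

Lemma act_out m gam xi : ~ I01 xi -> act m gam xi = xi.
Proof. by move=> Ix; rewrite /act memNset. Qed.

Lemma code_act m gam xi : I01 xi ->
  N m * act m gam xi = N m * xi - (code (pos m xi))%:R +
    (code (shift (vec m gam) (pos m xi)))%:R.
Proof.
move=> Ix; rewrite act_in// mulrDr /offset mulrC [N m * (_ / _)]mulrC divfK.
  by ring.
by rewrite gt_eqF ?N_gt0.
Qed.

Lemma act_I m gam xi : I01 xi -> I01 (act m gam xi).
Proof.
move=> Ix; have /andP[c1 c2] := code_itv m Ix; have := code_act m gam Ix.
have cs := code_lt (shift (vec m gam) (pos m xi)).
move: c1 c2; set c := code (pos m xi) => c1 c2 E; rewrite /= in_itv /=.
rewrite -(pmulr_rge0 _ (N_gt0 m)) -(ltr_pM2l (N_gt0 m)) mulr1 E.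
rewrite addr_ge0 ?subr_ge0//=.
have : (code (shift (vec m gam) (pos m xi))).+1%:R <= N m by rewrite ler_nat.
move: c2; rewrite -!natr1; lra.
Qed.

Lemma pos_act m gam xi : I01 xi ->
  pos m (act m gam xi) = shift (vec m gam) (pos m xi).
Proof.
move=> Ix; apply: pos_eq; first exact: act_I.
rewrite code_act//; have := code_itv m Ix; rewrite -!natr1; lra.
Qed.

Lemma act0 m xi : act m (fun=> 0) xi = xi.
Proof.
have [Ix|Ix] := pselect (I01 xi); last exact: act_out.
have v0 : vec m (fun=> 0 : F) = 0 by apply/ffunP => i; rewrite !ffunE.
by rewrite act_in// /offset v0 shift0 subrr mul0r addr0.
Qed.

Lemma actD m gam gam' xi :
  act m (fun k => gam k + gam' k) xi = act m gam (act m gam' xi).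
Proof.
have [Ix|Ix] := pselect (I01 xi); last by rewrite !act_out.
rewrite [RHS]act_in ?pos_act//; last exact: act_I.
rewrite !act_in// -addrA; congr (_ + _).
by rewrite /offset vecD shiftD -mulrDl; congr (_ / _); ring.
Qed.

Lemma act_step m gam xi : gam m = 0 -> act m.+1 gam xi = act m gam xi.
Proof.
move=> g0; have [Ix|Ix] := pselect (I01 xi); last by rewrite !act_out.
rewrite !act_in//; congr (_ + _); rewrite /offset code_shiftS//= pos_proj//.
rewrite !natrD opprD addrACA subrr addr0 card_stateS !natrM -mulrBl.
by rewrite -mulf_div divff ?mulr1// pnatr_eq0 -lt0n width_gt0.
Qed.

Lemma act_stable m n gam xi : (m <= n)%N -> (forall k, (m <= k)%N -> gam k = 0) ->
  act n gam xi = act m gam xi.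
Proof.
move=> /subnK <- g0; elim: (n - m)%N => [|j IHj]; first by rewrite add0n.
by rewrite addSn act_step ?g0 ?leq_addl.
Qed.

Definition cell m (x : state F m) : set (unit_type R) :=
  [set xi | I01 xi /\ pos m xi = x].

Lemma cellE m (x : state F m) :
  cell x = `[(code x)%:R / N m, (code x).+1%:R / N m[%classic.
Proof.
have N0 := N_gt0 m.
apply/seteqP; split=> xi; rewrite /cell /= [in X in _ -> X]in_itv /= ?in_itv /=.
  move=> [Ix <-]; have := code_itv m Ix.
  by rewrite ler_pdivrMr// ltr_pdivlMr// ![xi * _]mulrC.
rewrite ler_pdivrMr// ltr_pdivlMr// ![xi * _]mulrC => cx.
have Ix : I01 xi.
  rewrite /= in_itv /= -(pmulr_rge0 _ N0) -(ltr_pM2l N0) mulr1.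
  have /andP[c1 c2] := cx; rewrite (le_trans _ c1)//=.
  by apply: lt_le_trans c2 _; rewrite ler_nat code_lt.
split; last exact: pos_eq.
by move: Ix; rewrite /= in_itv.
Qed.

Lemma cell_sub m (x : state F m) : cell x `<=` I01.
Proof. by move=> xi []. Qed.

Lemma measurable_sub_unit (A : set (unit_type R)) : A `<=` I01 ->
  measurable A = lebesgue_measurable (A : set R).
Proof. by move=> AI; rewrite /measurable /= /unit_measurable /= setIidl. Qed.

Lemma measurable_cell m (x : state F m) : measurable (cell x).
Proof.
rewrite measurable_sub_unit; last exact: cell_sub.
by rewrite cellE; exact: lmeas_itv.
Qed.

Lemma mu_cell m (x : state F m) : mu (cell x) = ((N m)^-1)%:E.
Proof.
rewrite /unit_prob setIidl; last exact: cell_sub.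
have N0 := N_gt0 m.
rewrite cellE lam_itv /= lte_fin ltr_pM2r ?invr_gt0// ltr_nat ltnS leqnn.
by rewrite -EFinB -mulrBl -natr1 addrAC subrr add0r mul1r.
Qed.

Lemma mu_cells m (A : set (unit_type R)) : measurable A ->
  mu A = (\sum_(x : state F m) mu (A `&` cell x))%E.
Proof.
move=> mA; have -> : mu A = mu (A `&` I01) by rewrite /unit_prob -setIA setIid.
have -> : A `&` I01 = \bigcup_(x in [set: state F m]) (A `&` cell x).
  apply/seteqP; split=> [xi [Ax Ix]|xi [x _ [Ax [Ix _]]]]//.
  by exists (pos m xi).
rewrite measure_fin_bigcup//.
- rewrite (_ : [set: _] = [set` enum (state F m)]); last first.
    by apply/seteqP; split=> // x _ /=; rewrite mem_enum.
  by rewrite -fsbig_seq ?enum_uniq// big_enum.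
- exact: finite_finset.
- by apply/trivIsetP => x y _ _ xy; apply/seteqP; split=> // xi
    [[_ [_ px]] [_ [_ py]]]; move: xy; rewrite -px -py eqxx.
- by move=> x _; apply: measurableI => //; exact: measurable_cell.
Qed.

Lemma act_preimage_cell m gam (x : state F m) (A : set (unit_type R)) :
  act m gam @^-1` A `&` cell x =
  translate (offset gam x) (A `&` cell (shift (vec m gam) x)).
Proof.
apply/seteqP; split=> xi.
  move=> [+ [Ix <-]]; rewrite /preimage /translate /= -act_in// => Axi.
  by split=> //; split; [exact: act_I|exact: pos_act].
rewrite /translate /= => -[Axi cx].
have [Ix px] : cell x xi.
  move: cx; rewrite !cellE /= !in_itv /= /offset.
  by rewrite !mulrBl -!natr1 !mulrDl; lra.
by split=> //; rewrite /preimage /= act_in// px.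
Qed.

Lemma translate_cell_measurable m gam (x : state F m) (A : set (unit_type R)) :
  measurable A -> measurable (act m gam @^-1` A `&` cell x).
Proof.
move=> mA; rewrite measurable_sub_unit; last first.
  by apply: subset_trans (@cell_sub _ x); exact: subIsetr.
rewrite act_preimage_cell; apply: lmeas_translate.
rewrite -measurable_sub_unit; last first.
  by apply: subset_trans (@cell_sub _ _); exact: subIsetr.
by apply: measurableI => //; exact: measurable_cell.
Qed.

Lemma act_measurable m gam :
  measurable_fun setT (act m gam : unit_type R -> unit_type R).
Proof.
move=> _ A mA; rewrite setTI.
have : measurable (\bigcup_(x in [set: state F m]) (act m gam @^-1` A `&` cell x)).
  apply: fin_bigcup_measurable => [|x _]; first exact: finite_finset.
  exact: translate_cell_measurable.
suff -> : \bigcup_(x in [set: state F m]) (act m gam @^-1` A `&` cell x) =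
    act m gam @^-1` A `&` I01.
  by rewrite /measurable /= /unit_measurable /= -setIA setIid.
apply/seteqP; split=> [xi [x _ [Ax [Ix _]]]|xi [Ax Ix]]//.
by exists (pos m xi).
Qed.

Lemma act_preserving m gam (A : set (unit_type R)) : measurable A ->
  mu (act m gam @^-1` A) = mu A.
Proof.
move=> mA; rewrite (mu_cells m); last by rewrite -[_ @^-1` _]setTI; exact: act_measurable.
rewrite [RHS](mu_cells m)// [RHS](reindex_inj (@shift_inj _ _ (vec m gam))).
apply: eq_bigr => x _; rewrite act_preimage_cell /unit_prob.
rewrite (setIidl (_ : _ `<=` I01)); last first.
  rewrite -act_preimage_cell; apply: subset_trans (@cell_sub _ x).
  exact: subIsetr.
rewrite [in RHS](setIidl (_ : _ `<=` I01)); first exact: lam_translate.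
by apply: subset_trans (@cell_sub _ _); exact: subIsetr.
Qed.

Definition level m (P : pred (state F m)) : set (unit_type R) :=
  [set xi | I01 xi /\ P (pos m xi)].

Lemma levelE m (P : pred (state F m)) :
  level P = \bigcup_(x in [set x | P x]) cell x.
Proof.
apply/seteqP; split=> [xi [Ix Px]|xi [x Px [Ix px]]].
  by exists (pos m xi).
by split=> //; rewrite px.
Qed.

Lemma measurable_level m (P : pred (state F m)) : measurable (level P).
Proof.
rewrite levelE; apply: fin_bigcup_measurable => [|x _].
  exact: finite_finset.
  exact: measurable_cell.
Qed.

Lemma mu_level m (P : pred (state F m)) : mu (level P) = (mean (fun x => (P x)%:R))%:E.
Proof.
rewrite (mu_cells m); last exact: measurable_level.
rewrite /mean mulr_sumr -sumEFin; apply: eq_bigr => x _.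
have [Px|nPx] := boolP (P x).
  rewrite mulr1 -(mu_cell x); congr mu; apply/setIidPr => xi [Ix px].
  by split=> //; rewrite px.
rewrite mulr0 (_ : _ `&` _ = set0) ?measure0//.
apply/seteqP; split=> // xi [[_ + ] [_ px]]; rewrite px.
by rewrite (negbTE nPx).
Qed.

End Action.

Section Correlation.
Variables (R : realType) (F : finFieldType).
Implicit Types (m n j k : nat) (gam : nat -> F) (xi : R).
Local Notation I01 := (`[0, 1[%classic : set R).
Local Notation mu := (@unit_prob R).
Local Notation lev P := (@level R F _ P).

Lemma proj_iter_pos n j xi : I01 xi ->
  proj_iter (pos F (j + n) xi) = pos F n xi.
Proof.
move=> Ix; elim: j => //= j <-; congr proj_iter.
exact: (@pos_proj R F (j + n)).
Qed.

Lemma decor_ge0 n j gam : 0 <= decor R n j gam.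
Proof.
apply: prodr_ge0 => k _; rewrite subr_ge0 ler_pdivrMr ?ltr0n// mul1r.
by rewrite ler_nat; case: (_ != _).
Qed.

Lemma decor_factor_le1 n gam : 1 - (gam n != 0)%:R / n.+2%:R <= 1 :> R.
Proof. by rewrite gerBl divr_ge0. Qed.

Lemma decorS n j gam :
  decor R n j.+1 gam = decor R n j gam * (1 - (gam (j + n)%N != 0)%:R / (j + n).+2%:R).
Proof. by rewrite /decor addSn big_nat_recr ?leq_addl. Qed.

Lemma decor_le n j i gam : decor R n (i + j) gam <= decor R n j gam.
Proof.
elim: i => // i IHi; rewrite addSn decorS; apply: le_trans IHi.
by rewrite ler_piMr ?decor_ge0// decor_factor_le1.
Qed.

Lemma decor_le1 n j gam : decor R n j gam <= 1.
Proof.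
by rewrite -[j]addn0; apply: le_trans (decor_le _ _ _ _) _; rewrite /decor big_geq.
Qed.

Lemma mu_correlation n j m gam (P Q : pred (state F n)) :
  (forall k, (m <= k)%N -> gam k = 0) -> (m <= j + n)%N ->
  mu (lev P `&` act m gam @^-1` lev Q) =
  (decor R n j gam * mean (fun x => (P x && Q (shift (vec n gam) x))%:R) +
   (1 - decor R n j gam) * (mean (fun x => (P x)%:R) * mean (fun x => (Q x)%:R)))%:E.
Proof.
move=> g0 mjn.
pose S (x : state F (j + n)) := P (proj_iter x) &&
  Q (proj_iter (shift (vec (j + n) gam) x)).
have -> : lev P `&` act m gam @^-1` lev Q = lev S.
  apply/seteqP; split=> xi; rewrite /level /preimage /=.
    move=> [[Ix Px] [Ia Qx]]; split=> //; apply/andP.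
    rewrite proj_iter_pos// -pos_act// proj_iter_pos; last exact: act_I.
    by rewrite (act_stable xi mjn g0).
  move=> [Ix /andP[]]; rewrite proj_iter_pos// -pos_act// proj_iter_pos; last exact: act_I.
  by rewrite (act_stable xi mjn g0) => Px Qx; split=> //; split=> //; exact: act_I.
rewrite mu_level /S (mean_proj_iter j gam (fun x y => (P x && Q y)%:R)).
congr (_ + _ * _)%:E.
transitivity (mean (fun x => (P x)%:R * mean (fun y => (Q y)%:R : R))).
  apply: eq_mean => x; rewrite /mean mulrCA; congr (_ * _).
  by rewrite mulr_sumr; apply: eq_bigr => y _; rewrite -mulnb natrM.
by rewrite /mean -mulr_suml mulrA.
Qed.

Lemma mean_indic_itv (T : finType) (P : pred T) : 0 <= mean (fun x => (P x)%:R : R) <= 1.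
Proof.
have [T0|T0] := posnP #|T|; first by rewrite mean_indic T0 invr0 mulr0 lexx ler01.
rewrite mean_indic divr_ge0//= ler_pdivrMr ?ltr0n// mul1r ler_nat.
exact: max_card.
Qed.

Lemma level_mixing n j m gam (P Q : pred (state F n)) :
  (forall k, (m <= k)%N -> gam k = 0) ->
  `|fine (mu (lev P `&` act m gam @^-1` lev Q)) -
    fine (mu (lev P)) * fine (mu (lev Q))| <= decor R n j gam.
Proof.
move=> g0; apply: le_trans (decor_le n j m gam).
rewrite (@mu_correlation n (m + j))//; last by rewrite -addnA leq_addr.
rewrite !mu_level /=; set w := decor _ _ _ _; set c := mean _; set a := mean _.
set b := mean _.
have -> : w * c + (1 - w) * (a * b) - a * b = w * (c - a * b) by ring.
rewrite normrM ger0_norm ?decor_ge0// ler_piMr ?decor_ge0//.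
have /andP[c0 c1] : 0 <= c <= 1 := mean_indic_itv _.
have /andP[a0 a1] : 0 <= a <= 1 := mean_indic_itv _.
have /andP[b0 b1] : 0 <= b <= 1 := mean_indic_itv _.
rewrite ler_norml; have ab0 := mulr_ge0 a0 b0.
have ab1 : a * b <= 1 by rewrite mulr_ile1.
by apply/andP; split; lra.
Qed.

Lemma level_rigid n j m gam (P : pred (state F n)) :
  (forall k, (m <= k)%N -> gam k = 0) -> (m <= j + n)%N ->
  (forall k, (k < n)%N -> gam k = 0) ->
  fine (mu (act m gam @^-1` lev P `\` lev P)) <= 1 - decor R n j gam.
Proof.
move=> g0 mjn gn.
have mL := @measurable_level R F _ P.
have mT : measurable (act m gam @^-1` lev P).
  by rewrite -[_ @^-1` _]setTI; exact: act_measurable.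
have -> : mu (act m gam @^-1` lev P `\` lev P) =
    (mu (act m gam @^-1` lev P) - mu (lev P `&` act m gam @^-1` lev P))%E.
  by rewrite measureD// ?ltey_eq ?fin_num_measure// setIC.
rewrite (mu_correlation P P g0 mjn) act_preserving// mu_level.
rewrite -EFinB /=; set w := decor _ _ _ _; set a := mean (fun x => (P x)%:R).
have v0 : vec n gam = 0 by apply/ffunP => i; rewrite !ffunE gn.
have -> : mean (fun x => (P x && P (shift (vec n gam) x))%:R) = a :> R.
  by apply: eq_mean => x; rewrite v0 shift0 andbb.
have /andP[a0 a1] : 0 <= a <= 1 := mean_indic_itv _.
have -> : a - (w * a + (1 - w) * (a * a)) = (1 - w) * (a - a * a) by ring.
have w1 : 0 <= 1 - w by rewrite subr_ge0 decor_le1.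
rewrite ler_piMr//; have := mulr_ge0 a0 a0; lra.
Qed.

Lemma level_approx (A : set (unit_type R)) (e : R) : measurable A -> 0 < e ->
  exists M, forall n, (M <= n)%N -> exists P : pred (state F n),
    (mu (sdiff A (lev P)) <= e%:E)%E.
Proof.
move=> mA e0; have [M MP] := grid_approxP (mA : lebesgue_measurable (A `&` I01))
  (@subIsetr _ _ _) e0.
exists M => n Mn; have [|P PA] := MP #|state F n|.
  apply: leq_trans Mn _; apply: leq_trans (card_state_ge F n).
  exact/ltnW/ltn_expl.
exists (fun x => P (code x)); apply: le_trans PA; apply: le_lam.
move=> xi [+ Ix]; rewrite /sdiff /grid /level /= => -[[Ax nL]|[[_ Lx] nA]].
  left; split=> // -[_ Px]; apply: nL; split=> //.
  by rewrite code_pos.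
right; split; last by case=> -[].
by split=> //; rewrite -code_pos.
Qed.

End Correlation.

Section FolnerAverage.
Variables (R : realType) (G : countZmodType).
Implicit Types (S : {fset G}) (f : G -> R).

Definition favg S f : R := (#|` S|%:R)^-1 * \sum_(g <- S) f g.

Definition fdrift S (v : G) : R :=
  let S' := [fset (g + v)%R | g in S]%fset in
  #|` ((S' `\` S) `|` (S `\` S'))%fset|%:R / #|` S|%:R.

Lemma fsum_itv S f : (forall g, 0 <= f g <= 1) -> 0 <= \sum_(g <- S) f g <= #|` S|%:R.
Proof.
move=> f01; apply/andP; split; first by apply: sumr_ge0 => g _; case/andP: (f01 g).
apply: (@le_trans _ _ (\sum_(g <- S) 1)); last first.
  by rewrite big_const_seq count_predT iter_addr addr0.
by apply: ler_sum => g _; case/andP: (f01 g).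
Qed.

Lemma favg_shift S f v : (forall g, 0 <= f g <= 1) ->
  `|favg S (fun g => f (g + v)) - favg S f| <= fdrift S v.
Proof.
move=> f01; rewrite /favg -mulrBr normrM ger0_norm ?invr_ge0// /fdrift mulrC.
apply: ler_wpM2r; first by rewrite invr_ge0.
set S' := [fset _ | _ in _]%fset.
have -> : \sum_(g <- S) f (g + v) = \sum_(g <- S') f g.
  by rewrite big_imfset //= => x y _ _ /addIr.
have split (A B : {fset G}) : \sum_(g <- A) f g =
    \sum_(g <- (A `&` B)%fset) f g + \sum_(g <- (A `\` B)%fset) f g.
  rewrite (big_fsetID _ (mem B)) /=.
  by congr (_ + _); apply: eq_fbigl => x; rewrite !inE //= andbC.
rewrite (split S' S) (split S S') [(S `&` S')%fset]fsetIC.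
set x := \sum_(g <- (S' `\` S)%fset) _; set y := \sum_(g <- (S `\` S')%fset) _.
have /andP[x0 x1] : 0 <= x <= _ := fsum_itv _ f01.
have /andP[y0 y1] : 0 <= y <= _ := fsum_itv _ f01.
have cx : #|` (S' `\` S)%fset|%:R <= #|` ((S' `\` S) `|` (S `\` S'))%fset|%:R :> R.
  by rewrite ler_nat fsubset_leq_card// fsubsetUl.
have cy : #|` (S `\` S')%fset|%:R <= #|` ((S' `\` S) `|` (S `\` S'))%fset|%:R :> R.
  by rewrite ler_nat fsubset_leq_card// fsubsetUr.
by rewrite ler_norml; apply/andP; split; lra.
Qed.

Lemma ler_favg S f f' : (forall g, f g <= f' g) -> favg S f <= favg S f'.
Proof. by move=> ff'; apply: ler_wpM2l; rewrite ?invr_ge0//; apply: ler_sum. Qed.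

Lemma favg_ge0 S f : (forall g, 0 <= f g) -> 0 <= favg S f.
Proof. by move=> f0; rewrite mulr_ge0 ?invr_ge0// sumr_ge0. Qed.

Lemma favgDc S (c : R) f : 0 <= c -> favg S (fun g => c + f g) <= c + favg S f.
Proof.
move=> c0; rewrite /favg big_split /= mulrDr lerD2r.
rewrite big_const_seq count_predT iter_addr addr0 -[c *+ _]mulr_natr mulrCA.
have [->|n0] := eqVneq (#|` S|%:R : R) 0; first by rewrite mulr0 mulr0.
by rewrite mulVf// mulr1.
Qed.

End FolnerAverage.

Lemma cvg_sumr (R : realType) (I : Type) (r : seq I) (f : nat -> I -> R)
    (l : I -> R) : (forall i, f n i @[n --> \oo] --> l i) ->
  (\sum_(i <- r) f n i) @[n --> \oo] --> \sum_(i <- r) l i.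
Proof.
move=> fl; elim: r => [|i r IHr].
  by rewrite big_nil; under eq_fun do rewrite big_nil; exact: cvg_cst.
by rewrite big_cons; under eq_fun do rewrite big_cons; exact: cvgD.
Qed.

Section WeakMixing.
Variables (R : realType) (F : finFieldType) (G : countZmodType).
Variables (chi : nat -> {additive G -> F}) (bound : G -> nat) (dual : nat -> F -> G).
Hypothesis chi_bound : forall g k, (bound g <= k)%N -> chi k g = 0.
Hypothesis chi_dual : forall k b, chi k (dual k b) = b.
Hypothesis chi_dual_up : forall i k b, (i < k)%N -> chi k (dual i b) = 0.

Definition dec (i j : nat) (g : G) : R :=
  \prod_(i <= k < j) (1 - (chi k g != 0)%:R / k.+2%:R).

Definition ratio (k : nat) : R := 1 - (1 - #|F|%:R^-1) / k.+2%:R.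

Lemma factor_itv (b : bool) (k : nat) : 0 <= (1 - b%:R / k.+2%:R : R) <= 1.
Proof.
rewrite subr_ge0 ler_pdivrMr ?ltr0n// mul1r ler_nat gerBl divr_ge0// andbT.
by case: b.
Qed.

Lemma dec_itv i j g : 0 <= dec i j g <= 1.
Proof.
rewrite /dec; elim/big_ind: _ => [|x y /andP[x0 x1] /andP[y0 y1]|k _].
- by rewrite ler01 lexx.
- by rewrite mulr_ge0// mulr_ile1.
- exact: factor_itv.
Qed.

Lemma sum_factor k (c : F) :
  \sum_(b : F) (1 - (b + c != 0)%:R / k.+2%:R) = #|F|%:R * ratio k.
Proof.
rewrite (reindex_inj (addIr (- c))) /=; under eq_bigr do rewrite subrK.
have E (b : F) : 1 - (b != 0)%:R / k.+2%:R =
    (1 - k.+2%:R^-1) + (b == 0)%:R / k.+2%:R :> R.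
  by case: (b == 0) => /=; rewrite ?mul0r ?mul1r ?subr0 ?addr0 ?subrK.
under eq_bigr do rewrite E.
rewrite big_split /= sumr_const -[_ *+ _]mulr_natl -mulr_suml.
rewrite [\sum_(i : F) _](bigD1 0) //= eqxx big1 ?addr0 => [|b /negbTE->//].
rewrite /ratio; have q0 : #|F|%:R != 0 :> R.
  by rewrite pnatr_eq0 -lt0n; apply/card_gt0P; exists 0.
have k0 : k.+2%:R != 0 :> R by rewrite pnatr_eq0.
rewrite -[#|xpredT|]/#|F| (_ : true%:R = 1 :> R)//.
move: q0 k0; move: #|F|%:R k.+2%:R => q k1 H1 H2.
by field; rewrite H1 H2.
Qed.

Lemma sum_dec i j g : (i < j)%N ->
  \sum_(b : F) dec i j (g + dual i b) = #|F|%:R * (ratio i * dec i.+1 j g).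
Proof.
move=> ij; rewrite mulrA -(sum_factor i (chi i g)) mulr_suml; apply: eq_bigr => b _.
rewrite /dec big_ltn// raddfD /= chi_dual [chi i g + b]addrC; congr (_ * _).
by apply: eq_big_nat => k /andP[ik _]; rewrite raddfD /= chi_dual_up// addr0.
Qed.

Variable Phi : nat -> {fset G}.
Hypothesis Phi_folner : folner R Phi.

Lemma favg_dec i j : (i <= j)%N ->
  favg (Phi N) (dec i j) @[N --> \oo] --> \prod_(i <= k < j) ratio k.
Proof.
move=> ij; rewrite -(subKn ij); elim: (j - i)%N (leq_subr i j) => [|l IHl] lj.
  rewrite subn0 big_geq//; apply: cvg_near_cst; near=> N.
  rewrite /favg /dec; under eq_bigr do rewrite big_geq//.
  rewrite big_const_seq count_predT iter_addr addr0 mulVf//.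
  by rewrite pnatr_eq0 cardfs_eq0; case: Phi_folner.
have lj' := ltnW lj; move: (IHl lj').
have -> : (j - l)%N = (j - l.+1).+1 by rewrite -subSn.
have lt : (j - l.+1 < j)%N by rewrite ltn_subrL; apply: leq_trans lj.
set n := (j - l.+1)%N in lt *.
move=> cl; rewrite (big_ltn lt).
have q0 : #|F|%:R != 0 :> R by rewrite pnatr_eq0 -lt0n; apply/card_gt0P; exists 0.
have drift : (#|F|%:R^-1 * \sum_(b : F) fdrift R (Phi N) (dual n b))
    @[N --> \oo] --> (0 : R).
  rewrite [X in _ --> X](_ : 0 = #|F|%:R^-1 * \sum_(b : F) 0); last first.
    by rewrite big1 ?mulr0.
  apply: cvgMr; apply: cvg_sumr => b.
  exact: (Phi_folner.2 (dual n b)).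
apply/cvgrPdist_le => e e0; have e20 : 0 < e / 2 by rewrite divr_gt0.
have cl' : (ratio n * favg (Phi N) (dec n.+1 j)) @[N --> \oo] -->
   ratio n * \prod_(n.+1 <= k < j) ratio k by apply: cvgMr.
move/cvgrPdist_le : cl' => /(_ _ e20) cl'.
move/cvgrPdist_le : drift => /(_ _ e20) drift.
near=> N.
have step : `|ratio n * favg (Phi N) (dec n.+1 j) - favg (Phi N) (dec n j)| <= e / 2.
  have -> : ratio n * favg (Phi N) (dec n.+1 j) =
      #|F|%:R^-1 * \sum_(b : F) favg (Phi N) (fun g => dec n j (g + dual n b)).
    transitivity (#|F|%:R^-1 * (#|` (Phi N)|%:R^-1 *
        \sum_(g <- (Phi N)) #|F|%:R * (ratio n * dec n.+1 j g))).
      rewrite /favg -!mulr_sumr; move: (\sum_(g <- (Phi N)) _) (#|` (Phi N)|%:R^-1) => s c.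
      by rewrite [c * (#|F|%:R * _)]mulrCA mulKf// mulrCA.
    congr (_ * _); rewrite /favg -[in RHS]mulr_sumr exchange_big; congr (_ * _).
    by apply: eq_bigr => g _; rewrite sum_dec.
  have -> : favg (Phi N) (dec n j) = #|F|%:R^-1 * \sum_(b : F) favg (Phi N) (dec n j).
    by rewrite sumr_const -[favg _ _ *+ _]mulr_natl mulKf.
  rewrite -mulrBr -sumrB normrM ger0_norm ?invr_ge0//.
  apply: (@le_trans _ _ (#|F|%:R^-1 * \sum_(b : F) fdrift R (Phi N) (dual n b))).
    apply: ler_wpM2l; first by rewrite invr_ge0.
    apply: le_trans (ler_norm_sum _ _ _) _; apply: ler_sum => b _.
    by apply: favg_shift => g; exact: dec_itv.
  apply: le_trans (ler_norm _) _; rewrite -normrN -sub0r.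
  by near: N; exact: drift.
rewrite [e]splitr; apply: le_trans (ler_distD (ratio n * favg (Phi N) (dec n.+1 j)) _ _) _.
by apply: lerD => //; near: N; exact: cl'.
Unshelve. all: by end_near. Qed.

Lemma ratio_itv k : 0 <= ratio k <= 1 - (2 * k.+2%:R)^-1.
Proof.
have q2 : #|F|%:R^-1 <= 2^-1 :> R.
  have c2 : (2 <= #|F|)%N := finNzRing_gt1 F.
  by rewrite lef_pV2 ?posrE ?ltr0n// ?ler_nat//; exact: leq_trans c2.
have qi0 : 0 <= #|F|%:R^-1 :> R by rewrite invr_ge0.
have k0 : 0 < k.+2%:R^-1 :> R by rewrite invr_gt0.
have k1 : k.+2%:R^-1 <= 1 :> R by rewrite invf_le1// ler1n.
rewrite /ratio invfM; move: q2 qi0 k0 k1.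
move: (#|F|%:R^-1) (k.+2%:R^-1) => q c q2 q0 c0 c1.
apply/andP; split; nra.
Qed.

Lemma prod_ratio_sqr i j : (i <= j)%N ->
  (\prod_(i <= k < j) ratio k) ^+ 2 <= i.+2%:R / j.+2%:R.
Proof.
move=> /subnK <-; elim: (j - i)%N => [|l IHl].
  by rewrite add0n big_geq// expr1n divff// pnatr_eq0.
rewrite addSn big_nat_recr ?leq_addl//= exprMn.
set k := (l + i)%N in IHl *.
have k0 : 0 < k.+2%:R :> R by rewrite ltr0n.
have k30 : 0 < k.+3%:R :> R by rewrite ltr0n.
have r : ratio k ^+ 2 <= k.+2%:R / k.+3%:R.
  have /andP[r0 r1] := ratio_itv k.
  apply: (@le_trans _ _ ((1 - (2 * k.+2%:R)^-1) ^+ 2)).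
    by rewrite ler_pXn2r// nnegrE; apply: le_trans r1.
  rewrite -[k.+3%:R]natr1; rewrite -[k.+3%:R]natr1 in k30.
  have k1 : 1 <= k.+2%:R :> R by rewrite ler1n.
  move: k0 k30 k1; move: k.+2%:R => K K0 K1 K2.
  rewrite ler_pdivlMr//.
  have -> : (1 - (2 * K)^-1) ^+ 2 * (K + 1) = K - (3 * K - 1) / (4 * K ^+ 2).
    by field; rewrite gt_eqF.
  rewrite gerBl divr_ge0//; first lra.
  by rewrite mulr_ge0// sqr_ge0.
apply: le_trans (ler_pM _ _ IHl r) _; rewrite ?sqr_ge0//.
by rewrite mulrA divfK// gt_eqF.
Qed.


End WeakMixing.

Section RigiditySequence.
Variables (R : realType) (F : finFieldType) (G : countZmodType).
Variables (chi : nat -> {additive G -> F}) (bound : G -> nat) (dual : nat -> F -> G).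
Hypothesis chi_bound : forall g k, (bound g <= k)%N -> chi k g = 0.
Hypothesis chi_dual : forall k b, chi k (dual k b) = b.
Hypothesis chi_dual_up : forall i k b, (i < k)%N -> chi k (dual i b) = 0.

Local Notation mu := (@unit_prob R).
Local Notation lev P := (@level R F _ P).
Local Notation dec := (dec R chi).

Definition coord (g : G) (k : nat) : F := chi k g.

Definition coord_act (g : G) : unit_type R -> unit_type R :=
  act (bound g) (coord g).

Lemma coord_actE m g xi : (bound g <= m)%N -> coord_act g xi = act m (coord g) xi.
Proof. by move=> bm; rewrite /coord_act (act_stable xi bm (@chi_bound g)). Qed.

Lemma coord_act_system : measure_preserving_action mu coord_act.
Proof.
split.
- move=> xi; rewrite /coord_act (_ : coord 0 = fun=> 0); first exact: act0.
  by apply/funext => k; rewrite /coord raddf0.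
- move=> g h xi; pose m := maxn (bound (g + h)) (maxn (bound g) (bound h)).
  rewrite !(@coord_actE m) ?leq_max ?leqnn ?orbT//.
  rewrite -actD; congr act; apply/funext => k; exact: raddfD.
- by move=> g; exact: act_measurable.
- by move=> g A mA; exact: act_preserving.
Qed.

Lemma coord_act_image g (A : set (unit_type R)) :
  coord_act g @` A = coord_act (- g) @^-1` A.
Proof.
have [a0 aD _ _] := coord_act_system.
apply/seteqP; split=> [_ [xi Ax <-]|xi Axi]; first by rewrite /preimage /= -aD addNr a0.
by exists (coord_act (- g) xi) => //; rewrite -aD addrN a0.
Qed.

Lemma fine_sdiff (A B : set (unit_type R)) : measurable A -> measurable B ->
  `|fine (mu A) - fine (mu B)| <= fine (mu (sdiff A B)).
Proof.
move=> mA mB; have mD : measurable (sdiff A B).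
  by apply: measurableU; exact: measurableD.
have le (C D : set (unit_type R)) : measurable C -> measurable D ->
    C `<=` D `|` sdiff A B -> fine (mu C) <= fine (mu D) + fine (mu (sdiff A B)).
  move=> mC mDD CD; rewrite -fineD ?fin_num_measure//.
  apply: fine_le; rewrite ?fin_numD ?fin_num_measure//.
  apply: le_trans (measureU2 _ mDD mD).
  by apply: le_measure; rewrite ?inE//; exact: measurableU.
rewrite ler_norml; apply/andP; split.
  rewrite lerNl opprB lerBlDl; apply: le => // x Bx.
  by have [Ax|nAx] := pselect (A x); [left|right; right].
rewrite lerBlDl; apply: le => // x Ax.
by have [Bx|nBx] := pselect (B x); [left|right; left].
Qed.

Lemma fine_unit_prob_itv (A : set (unit_type R)) : measurable A -> 0 <= fine (mu A) <= 1.
Proof.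
move=> mA; rewrite fine_ge0//= -[leRHS]/(fine 1%E).
by apply: fine_le; rewrite ?fin_num_measure//; exact: probability_le1.
Qed.

Lemma preimage_measurable g (A : set (unit_type R)) : measurable A ->
  measurable (coord_act g @^-1` A).
Proof. by move=> mA; rewrite -[_ @^-1` _]setTI; exact: act_measurable. Qed.

Lemma mixing_approx (A B : set (unit_type R)) (e : R) : measurable A ->
  measurable B -> 0 < e -> exists n, forall j g,
  `|fine (mu (A `&` coord_act g @` B)) - fine (mu A) * fine (mu B)| <=
    e + dec n (j + n) g.
Proof.
move=> mA mB e0; have e40 : 0 < e / 4 by rewrite divr_gt0.
have [M MP] := level_approx F mA e40; have [M' MP'] := level_approx F mB e40.
pose n := maxn M M'; exists n => j g.
have [P PA] := MP n (leq_maxl _ _); have [Q QB] := MP' n (leq_maxr _ _).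
have mP : measurable (lev P) := measurable_level P.
have mQ : measurable (lev Q) := measurable_level Q.
rewrite coord_act_image; set T := coord_act (- g).
have mTB : measurable (T @^-1` B) := preimage_measurable _ mB.
have mTQ : measurable (T @^-1` lev Q) := preimage_measurable _ mQ.
have mix : `|fine (mu (lev P `&` T @^-1` lev Q)) -
    fine (mu (lev P)) * fine (mu (lev Q))| <= dec n (j + n) g.
  have := @level_mixing R F n j _ _ P Q (@chi_bound (- g)).
  congr (is_true (_ <= _)); apply: eq_bigr => k _.
  by rewrite /coord raddfN oppr_eq0.
have fA : fine (mu (sdiff A (lev P))) <= e / 4.
  by rewrite -lee_fin fineK ?fin_num_measure//; apply: measurableU; exact: measurableD.
have fB : fine (mu (sdiff B (lev Q))) <= e / 4.
  by rewrite -lee_fin fineK ?fin_num_measure//; apply: measurableU; exact: measurableD.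
have a1 := le_trans (fine_sdiff mA mP) fA.
have b1 := le_trans (fine_sdiff mB mQ) fB.
have c1 : `|fine (mu (A `&` T @^-1` B)) - fine (mu (lev P `&` T @^-1` lev Q))| <= e / 4 + e / 4.
  apply: le_trans (fine_sdiff _ _) _; try exact: measurableI.
  have mDA : measurable (sdiff A (lev P)) by apply: measurableU; exact: measurableD.
  have mDB : measurable (sdiff B (lev Q)) by apply: measurableU; exact: measurableD.
  have mTD : measurable (T @^-1` sdiff B (lev Q)) := preimage_measurable _ mDB.
  apply: le_trans (lerD fA fB).
  rewrite -(act_preserving (bound (- g)) (coord (- g)) mDB).
  rewrite -fineD ?fin_num_measure//; apply: fine_le.
  - by rewrite fin_num_measure//; apply: measurableU; apply: measurableD; exact: measurableI.
  - by rewrite fin_numD !fin_num_measure.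
  apply: le_trans (measureU2 _ mDA mTD); apply: le_measure; rewrite ?inE.
  - by apply: measurableU; apply: measurableD; exact: measurableI.
  - exact: measurableU.
  move=> x; rewrite /sdiff /preimage /=.
  have [Ax|nAx] := pselect (A x); have [Px|nPx] := pselect (lev P x);
  have [Bx|nBx] := pselect (B (T x)); have [Qx|nQx] := pselect (lev Q (T x)); tauto.
have /andP[pa0 pa1] := fine_unit_prob_itv mA; have /andP[pb0 pb1] := fine_unit_prob_itv mB.
have /andP[pp0 pp1] := fine_unit_prob_itv mP; have /andP[pq0 pq1] := fine_unit_prob_itv mQ.
move: mix a1 b1 c1 pa0 pa1 pb0 pb1 pp0 pp1 pq0 pq1.
move: (fine (mu A)) (fine (mu B)) (fine (mu (lev P))) (fine (mu (lev Q))) => a b p q.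
move: (fine _) (fine _) => s c mix a1 b1 c1 a0 a2 b0 b2 p0 p2 q0 q2.
have pq : `|a * b - p * q| <= e / 4 + e / 4.
  have -> : a * b - p * q = (a - p) * b + p * (b - q) by ring.
  apply: le_trans (ler_normD _ _) _; rewrite !normrM (ger0_norm b0) (ger0_norm p0).
  apply: lerD; first by rewrite -[leRHS]mulr1 ler_pM.
  by rewrite -[leRHS]mul1r ler_pM.
move: mix c1 pq; rewrite !ler_norml => /andP[? ?] /andP[? ?] /andP[? ?].
by apply/andP; split; lra.
Qed.

Lemma coord_act_mixing : weakly_mixing mu coord_act.
Proof.
move=> A B Phi mA mB PhiF; apply/cvgrPdist_le => e e0.
have e20 : 0 < e / 2 by rewrite divr_gt0.
have e40 : 0 < e / 4 by rewrite divr_gt0.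
have [n nP] := mixing_approx mA mB e20.
have [j jP] : exists j, \prod_(n <= k < j + n) ratio R F k <= e / 4.
  have z : 0 < n.+2%:R / (e / 4) ^+ 2 by rewrite divr_gt0// exprn_gt0.
  exists (Num.truncn (n.+2%:R / (e / 4) ^+ 2)); set j := Num.truncn _.
  have := prod_ratio_sqr R F (leq_addl j n); set p := \prod_(_ <= _ < _) _ => pj.
  have p0 : 0 <= p by apply: prodr_ge0 => k _; case/andP: (ratio_itv R F k).
  rewrite -(@ler_pXn2r _ 2)// ?nnegrE ?(ltW e40)//; apply: le_trans pj _.
  rewrite ler_pdivrMr ?ltr0n// mulrC -ler_pdivrMr ?exprn_gt0//.
  apply: ltW; apply: lt_le_trans (_ : j.+1%:R <= _).
    by case/andP: (truncn_itv (ltW z)).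
  by rewrite ler_nat; lia.
have := favg_dec chi_dual chi_dual_up PhiF (leq_addl j n).
move=> /cvgrPdist_le /(_ _ e40) cd; near=> N.
have dN : favg (Phi N) (dec n (j + n)) <= e / 2.
  have : `|\prod_(n <= k < j + n) ratio R F k - favg (Phi N) (dec n (j + n))| <= e / 4.
    by near: N.
  rewrite ler_norml => /andP[d1 d2]; lra.
pose f g := `|fine (mu (A `&` coord_act g @` B)) - fine (mu A) * fine (mu B)|.
rewrite sub0r normrN -/(favg (Phi N) f).
rewrite ger0_norm; last by apply: favg_ge0 => g; rewrite /f.
apply: le_trans (ler_favg _ (nP j)) _.
apply: le_trans (favgDc _ _ (ltW e20)) _.
by rewrite [leRHS]splitr lerD2l.
Unshelve. all: by end_near. Qed.

Variable a : nat -> G.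
Hypothesis a_coord : forall k, \forall n \near \oo, chi k (a n) = 0.
Hypothesis a_single : \forall n \near \oo, forall i k,
  chi i (a n) != 0 -> chi k (a n) != 0 -> i = k.

Lemma coord_act_rigid : rigid_along mu coord_act a.
Proof.
have [_ _ mT muT] := coord_act_system.
apply: (@rigid_of_sets R _ _ mu (fun n => coord_act (a n))) => //.
  by move=> n A; exact: muT.
move=> A mA.
have mTA n : measurable (coord_act (a n) @^-1` A) := preimage_measurable _ mA.
apply/fine_cvgP; split.
  by near=> n; rewrite fin_num_measure//; exact: measurableD.
apply/cvgrPdist_le => e e0; have e30 : 0 < e / 3 by rewrite divr_gt0.
have [M MP] := level_approx F mA e30.
pose J := maxn M (Num.truncn (3 / e)).
have [P PA] := MP J (leq_maxl _ _).
have Je : J.+2%:R^-1 <= e / 3.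
  have t0 : 0 < 3 / e by rewrite divr_gt0.
  rewrite -[leRHS]invrK invf_div lef_pV2 ?posrE ?ltr0n//.
  apply: (@le_trans _ _ (Num.truncn (3 / e)).+1%:R).
    by case/andP: (truncn_itv (ltW t0)) => _ /ltW.
  by rewrite ler_nat; apply: leqW; rewrite ltnS /J leq_max leqnn orbT.
have a_low : \forall n \near \oo, forall k, (k < J)%N -> chi k (a n) = 0.
  elim: J {P PA Je} => [|J IHJ]; first by apply: nearW.
  near=> n => k; rewrite ltnS leq_eqVlt => /orP[/eqP->|].
    by near: n; exact: a_coord.
  by move: k; near: n.
near=> n.
have low k : (k < J)%N -> coord (a n) k = 0 by move: k; near: n.
have single i k : coord (a n) i != 0 -> coord (a n) k != 0 -> i = k.
  by move: i k; near: n.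
have decJ j : 1 - e / 3 <= decor R J j (coord (a n)).
  suff : 1 - J.+2%:R^-1 <= decor R J j (coord (a n)).
    by apply: le_trans; rewrite lerD2l lerN2.
  have [[k nk]|allz] := pselect (exists k, coord (a n) k != 0); last first.
    rewrite /decor big1 ?gerBl ?invr_ge0// => k _.
    case: eqP => [_|ck]; first by rewrite mul0r subr0.
    by case: allz; exists k; apply/eqP.
  have Jk : (J <= k)%N by rewrite leqNgt; apply: contra nk => /low ->.
  apply: (@le_trans _ _ (1 - k.+2%:R^-1)).
    by rewrite lerD2l lerN2 lef_pV2 ?posrE ?ltr0n// ler_nat !ltnS.
  have [kj|jk] := ltnP k (j + J).
    rewrite /decor (bigD1_seq k) ?iota_uniq ?mem_index_iota ?Jk//= nk mul1r.
    rewrite big1 ?mulr1// => i ik.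
    case: eqP => [_|/eqP ci]; first by rewrite mul0r subr0.
    by move: ik; rewrite (single _ _ ci nk) eqxx.
  rewrite /decor big_nat_cond big1 ?gerBl ?invr_ge0// => i /andP[/andP[Ji ij] _].
  case: eqP => [_|/eqP ci]; first by rewrite mul0r subr0.
  by move: (leq_trans ij jk); rewrite (single _ _ ci nk) ltnn.
have mP : measurable (lev P) := measurable_level P.
set T := coord_act (a n).
have mTP : measurable (T @^-1` lev P) := preimage_measurable _ mP.
have mD : measurable (sdiff A (lev P)) by apply: measurableU; exact: measurableD.
have mAP : measurable (T @^-1` (A `\` lev P)).
  by apply: preimage_measurable; exact: measurableD.
have r1 : fine (mu (T @^-1` lev P `\` lev P)) <= e / 3.
  have := level_rigid R P (@chi_bound (a n)) (leq_addr J _) low.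
  by move/le_trans; apply; have := decJ (bound (a n)); lra.
have r2 : fine (mu (sdiff A (lev P))) <= e / 3.
  by rewrite -lee_fin fineK ?fin_num_measure.
have le (C : set (unit_type R)) : measurable C -> C `<=` sdiff A (lev P) ->
    (mu C <= (e / 3)%:E)%E.
  move=> mC CD; apply: (@le_trans _ _ (mu (sdiff A (lev P)))).
    by apply: le_measure; rewrite ?inE.
  by rewrite -[leLHS]fineK ?fin_num_measure.
have mTAA : measurable (T @^-1` A `\` A) := measurableD (mTA n) mA.
have mTPP : measurable (T @^-1` lev P `\` lev P) by exact: measurableD.
have mPA : measurable (lev P `\` A) by exact: measurableD.
have main : (mu (T @^-1` A `\` A) <= e%:E)%E.
  have -> : e = e / 3 + e / 3 + e / 3 by field.
  apply: (@le_trans _ _ (mu ((T @^-1` lev P `\` lev P `|` T @^-1` (A `\` lev P)) `|`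
      (lev P `\` A)))).
    apply: le_measure; rewrite ?inE//.
      by apply: measurableU => //; exact: measurableU.
    move=> x; rewrite /preimage /=.
    by have [Tx|nTx] := pselect (lev P (T x)); have [Px|nPx] := pselect (lev P x); tauto.
  apply: le_trans (measureU2 _ _ mPA) _; first exact: measurableU.
  rewrite !EFinD; apply: leeD; last by apply: le => //; exact: subsetUr.
  apply: le_trans (measureU2 _ mTPP mAP) _; apply: leeD.
    by rewrite -[leLHS]fineK ?fin_num_measure.
  rewrite -[leLHS]/(mu (T @^-1` (A `\` lev P))) muT; last exact: measurableD.
  by apply: le; [exact: measurableD|exact: subsetUl].
rewrite sub0r normrN ger0_norm ?fine_ge0//.
by rewrite -lee_fin fineK ?fin_num_measure.
Unshelve. all: by end_near. Qed.

Theorem rigidity_sequence_of_coordinates : rigidity_sequence R a.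
Proof.
exists _, _, mu, coord_act; split.
- exact: unit_prob_lebesgue.
- exact: coord_act_system.
- exact: coord_act_mixing.
- exact: coord_act_rigid.
Qed.


End RigiditySequence.


(** * Polynomials over F[t] and F(t) *)

Section IrreducibleFactors.
Variable K : fieldType.
Implicit Types (p q f : {poly K}).

Lemma irreducible_factor p : (1 < size p)%N ->
  exists f, [/\ irreducible_poly f, f \is monic & f %| p].
Proof.
have [n] := ubnP (size p); elim: n p => // n IHn p /ltnSE pn p1.
have p0 : p != 0 by rewrite -size_poly_gt0 ltnW.
have [irr|nirr] := pselect (forall q, size q != 1%N -> q %| p -> q %= p).
  exists ((lead_coef p)^-1 *: p).
  have lc0 : (lead_coef p)^-1 != 0 by rewrite invr_eq0 lead_coef_eq0.
  split; last by rewrite dvdpZl.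
  - split; first by rewrite size_scale.
    move=> q q1; rewrite dvdpZr// => /irr -/(_ q1) qp.
    by rewrite (eqp_trans qp)// eqp_sym eqp_scale.
  - by rewrite monicE lead_coefZ mulVf// lead_coef_eq0.
have [q [q1 qp nqp]] : exists q, [/\ size q != 1%N, q %| p & ~~ (q %= p)].
  apply: contra_notP nirr => nq q q1 qp; apply/negPn/negP => nqp.
  by apply: nq; exists q.
have q0 : q != 0 by apply: contraTneq qp => ->; rewrite dvd0p.
have sq : (size q < size p)%N.
  by rewrite ltn_neqAle dvdp_leq// andbT dvdp_size_eqp.
have [||f [irrf mf fq]] := IHn q; first exact: leq_trans sq pn.
  by rewrite ltn_neqAle eq_sym q1 size_poly_gt0.
by exists f; split=> //; exact: dvdp_trans qp.
Qed.

Lemma irreducible_euclid f p q : irreducible_poly f -> f %| p * q ->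
  (f %| p) || (f %| q).
Proof.
move=> irr fpq; have [//|nfp] := boolP (f %| p).
suff cfp : coprimep f p by rewrite -(Gauss_dvdpr _ cfp).
by rewrite irreducible_poly_coprime.
Qed.

Lemma size_dvdp_lt f p : (1 < size f)%N -> p != 0 -> (size p < size (f * p)%R)%N.
Proof.
move=> f1 p0; have f0 : f != 0 by rewrite -size_poly_gt0 ltnW.
by rewrite size_mul// ltn_predRL -[(size p).+1]add1n ltn_add2r.
Qed.

End IrreducibleFactors.

Section GaussLemma.
Variable F : fieldType.
Local Notation Z := {poly F}.
Local Notation "x %:Fr" := (@FracField.tofrac Z x).
Local Notation frac_poly := (map_poly (@FracField.tofrac Z)).

Lemma prime_content (f : Z) (P Q : {poly Z}) : irreducible_poly f ->
  (forall i, f %| (P * Q)`_i) -> (forall i, f %| P`_i) \/ (forall i, f %| Q`_i).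
Proof.
move=> irr fPQ; apply: contrapT => /not_orP[/existsNP/cid nP /existsNP/cid nQ].
have {nP}exP : exists i, ~~ (f %| P`_i) by case: nP => i /negP; exists i.
have {nQ}exQ : exists i, ~~ (f %| Q`_i) by case: nQ => i /negP; exists i.
case: (ex_minnP exP) => i Pi mini; case: (ex_minnP exQ) => j Qj minj.
have lowP k : (k < i)%N -> f %| P`_k.
  by move=> ki; apply: contraTT ki => /mini; rewrite -leqNgt.
have lowQ k : (k < j)%N -> f %| Q`_k.
  by move=> kj; apply: contraTT kj => /minj; rewrite -leqNgt.
have := fPQ (i + j)%N; rewrite coefM.
have ij : (i < (i + j).+1)%N by rewrite ltnS leq_addr.
rewrite (bigD1 (Ordinal ij)) //= addKn dvdp_addl.
  by move/(irreducible_euclid irr); rewrite (negbTE Pi) (negbTE Qj).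
elim/big_ind: _ => [|x y|k ki]; [exact: dvdp0|exact: dvdp_add|].
have [kl|ke|kg] := ltngtP (k : nat) i.
- by apply: dvdp_mulr; exact: lowP.
- by apply: dvdp_mull; apply: lowQ; have := ltn_ord k; lia.
- by case/eqP: ki; exact/val_inj.
Qed.

Lemma frac_quotient (c : {fraction Z}) :
  exists u v : Z, v != 0 /\ c * v%:Fr = u%:Fr.
Proof.
rewrite -[c]reprK; move: (repr c) => r.
exists r.1, r.2; have v0 := denom_ratioP r; split=> //.
unlock FracField.tofrac; rewrite [LHS](_ : _ =
  (\pi_{fraction Z} (FracField.mulf r (Ratio r.2 1)))%qT); last first.
  exact/esym/FracField.pi_mul.
apply/eqmodP; rewrite /= FracField.equivfE /FracField.mulf.
by rewrite !numden_Ratio ?mulr1 ?mulf_neq0 ?oner_eq0// mulrC.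
Qed.

Lemma tofrac_inj : injective (@FracField.tofrac Z).
Proof. by move=> x y /eqP; rewrite tofrac_eq => /eqP. Qed.

Lemma frac_poly_inj : injective frac_poly.
Proof. by apply: map_inj_poly; [exact: tofrac_inj|exact: rmorph0]. Qed.

Lemma frac_poly_monic (P : {poly Z}) : (frac_poly P \is monic) = (P \is monic).
Proof.
rewrite !monicE lead_coef_map_inj ?rmorph0//; last exact: tofrac_inj.
by rewrite -(rmorph1 (@FracField.tofrac Z)) (inj_eq tofrac_inj).
Qed.

Definition clears (d : Z) (p : {poly {fraction Z}}) :=
  d != 0 /\ exists P : {poly Z}, d%:Fr *: p = frac_poly P.

Lemma clears_ex p : exists d, clears d p.
Proof.
elim/poly_ind: p => [|p c [d [d0 [P dP]]]].
  by exists 1; split; [exact: oner_neq0|exists 0; rewrite scaler0 rmorph0].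
have [u [v [v0 cuv]]] := frac_quotient c.
exists (d * v); split; first by rewrite mulf_neq0.
exists ((v *: P) * 'X + (d * u)%:P).
rewrite [RHS]rmorphD [X in _ = X + _]rmorphM /= map_polyX map_polyC /=.
rewrite map_polyZ /= -dP.
have dv : (d * v)%:Fr = d%:Fr * v%:Fr by exact: rmorphM.
have du : (d * u)%:Fr = d%:Fr * u%:Fr by exact: rmorphM.
rewrite scalerDr dv du -!scalerAl scalerA [v%:Fr * _]mulrC; congr (_ + _).
by rewrite -mul_polyC -polyCM -cuv -mulrA [v%:Fr * c]mulrC.
Qed.

Lemma clears_min p : exists d, clears d p /\
  forall d', clears d' p -> (size d <= size d')%N.
Proof.
have [d0 cd0] := clears_ex p.
have ex : exists n, `[< exists d, clears d p /\ size d = n >].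
  by exists (size d0); apply/asboolP; exists d0.
case: (ex_minnP ex) => n /asboolP[d [cd <-]] mind; exists d; split=> // d' cd'.
by apply: mind; apply/asboolP; exists d'.
Qed.

Lemma clears_primitive d p P f : clears d p ->
  (forall d', clears d' p -> (size d <= size d')%N) ->
  d%:Fr *: p = frac_poly P -> p \is monic -> irreducible_poly f ->
  ~ (forall i, f %| P`_i).
Proof.
move=> [d0 _] mind dP mp irr fP; have f0 := irredp_neq0 irr.
have lead : P`_(size p).-1 = d.
  apply/eqP; rewrite -(@tofrac_eq Z) -coef_map -dP coefZ.
  by move: mp; rewrite monicE => /eqP; rewrite lead_coefE => ->; rewrite mulr1.
have fQ0 : f%:Fr != 0 by rewrite tofrac_eq0.
have [d' dE] : exists d', d = f * d'.
  by exists (d %/ f); rewrite mulrC divpK// -lead.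
have d'0 : d' != 0 by apply: contraNneq d0 => d'0; rewrite dE d'0 mulr0.
have : clears d' p.
  split=> //; exists (\poly_(i < size P) (P`_i %/ f)).
  apply: (scalerI fQ0); rewrite scalerA -rmorphM /= -dE dP.
  apply/polyP => i; rewrite coefZ !coef_map /= -rmorphM coef_poly /=.
  case: ltnP => [_|Pi]; first by rewrite mulrC divpK.
  by rewrite nth_default// mulr0.
move/mind; rewrite leqNgt dE size_dvdp_lt//; by case: irr.
Qed.

Lemma gauss_monic (p q : {poly {fraction Z}}) (P0 : {poly Z}) :
  p \is monic -> q \is monic -> p * q = frac_poly P0 ->
  exists2 P, P \is monic & p = frac_poly P.
Proof.
move=> mp mq pq; have [d [cd mind]] := clears_min p.
have [e [ce mine]] := clears_min q.
have [d0 [P dP]] := cd; have [e0 [Q eQ]] := ce.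
have d1 : size d = 1%N.
  apply/eqP; rewrite eqn_leq size_poly_gt0 d0 andbT leqNgt; apply/negP => d1.
  have [f [irr _ fd]] := irreducible_factor d1.
  have PQ : P * Q = (d * e) *: P0.
    apply: frac_poly_inj; rewrite rmorphM /= map_polyZ /= -dP -eQ -pq rmorphM /=.
    by rewrite -scalerAl -scalerAr scalerA.
  have fPQ i : f %| (P * Q)`_i by rewrite PQ coefZ -mulrA dvdp_mulr.
  have [] := prime_content irr fPQ.
    exact: (clears_primitive cd mind dP mp irr).
  exact: (clears_primitive ce mine eQ mq irr).
have /size_poly1P[c c0 dc] : size d == 1%N by rewrite d1.
have pE : p = frac_poly (c^-1%:P *: P).
  rewrite map_polyZ /= -dP scalerA dc -rmorphM /= -polyCM mulVf// rmorph1.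
  by rewrite scale1r.
exists (c^-1%:P *: P); last exact: pE.
by move: mp; rewrite pE frac_poly_monic.
Qed.

End GaussLemma.

Section EulerTrace.
Variable K : fieldType.
Implicit Types (P Q f : {poly K}) (a : K).

(* Euler's formula for the trace of [f] in the algebra [K[x] / (P)]. *)
Definition trace P f : K := (f * P^`() %% P)`_(size P).-2.

Lemma trace_mulXsubC Q a f : Q \is monic ->
  trace (('X - a%:P) * Q) f = f.[a] + trace Q f.
Proof.
move=> mQ; have Q0 := monic_neq0 mQ.
have sXM q : q != 0 -> size (('X - a%:P) * q) = (size q).+1.
  by move=> q0; rewrite size_monicM ?monicXsubC// size_XsubC.
have sX := sXM _ Q0.
have [g fE] : exists g, f = g * ('X - a%:P) + f.[a]%:P.
  have /factor_theorem[g gE] : root (f - f.[a]%:P) a.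
    by rewrite /root !hornerE subrr.
  by exists g; rewrite -gE subrK.
pose r := f * Q^`() %% Q; pose h := f * Q^`() %/ Q.
have rE : f * Q^`() = h * Q + r := divp_eq _ _.
have sr : (size r < size Q)%N by rewrite ltn_modp.
rewrite /trace sX; set P := _ * Q.
have -> : f * P^`() = (g + h) * P + (f.[a] *: Q + ('X - a%:P) * r).
  rewrite /P derivM derivXsubC mul1r mulrDr [f * (_ * _)]mulrCA rE {1}fE.
  by rewrite -mul_polyC; ring.
rewrite modp_addl_mul_small; last first.
  rewrite sX ltnS; apply: leq_trans (size_polyD _ _) _.
  rewrite geq_max (leq_trans (size_scale_leq _ _))//=.
  have [->|r0] := eqVneq r 0; first by rewrite mulr0 size_poly0.
  by rewrite sXM.
rewrite coefD coefZ -lead_coefE (monicP mQ) mulr1; congr (_ + _).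
have rtop : r`_(size Q).-1 = 0.
  by rewrite nth_default// -ltnS (ltn_predK sr).
rewrite -/r mulrBl coefB coefCM /= rtop mulr0 subr0.
rewrite coefXM; case: eqP => [Q1|//]; rewrite nth_default//.
by move: sr Q1; case: (size Q) => [|[|n]].
Qed.

Variable S : K -> Prop.
Hypothesis S0 : S 0.
Hypothesis SB : forall x y, S x -> S y -> S (x - y).
Hypothesis SM : forall x y, S x -> S y -> S (x * y).

Definition over P := forall i, S P`_i.

Lemma overB P Q : over P -> over Q -> over (P - Q).
Proof. by move=> SP SQ i; rewrite coefB; exact: SB. Qed.

Lemma closed_opp x : S x -> S (- x).
Proof. by rewrite -sub0r => Sx; exact: SB. Qed.

Lemma closed_add x y : S x -> S y -> S (x + y).
Proof. by move=> Sx Sy; rewrite -[y]opprK; apply/SB => //; exact: closed_opp. Qed.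

Lemma overM P Q : over P -> over Q -> over (P * Q).
Proof.
move=> SP SQ i; rewrite coefM.
elim/big_ind: _ => [|x y|j _]; [exact: S0|exact: closed_add|exact: SM].
Qed.

Lemma over_modp P Q : Q \is monic -> over Q -> over P -> over (P %% Q).
Proof.
move=> mQ SQ; have Q0 := monic_neq0 mQ.
have [n] := ubnP (size P); elim: n P => // n IHn P /ltnSE Pn SP.
have [PQ|QP] := ltnP (size P) (size Q); first by rewrite modp_small.
have sP : (0 < size P)%N by apply: leq_trans QP; rewrite size_poly_gt0.
pose M := lead_coef P *: 'X^(size P - size Q).
have sM : size (M * Q) = size P.
  rewrite -scalerAl size_scale ?lead_coef_eq0 -?size_poly_gt0//.
  by rewrite size_monicM ?monicXn// size_polyXn addSn /= subnK.
have SMQ : over (M * Q).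
  move=> i; rewrite -scalerAl coefZ coefXnM; apply: SM; first exact: SP.
  by case: ifP.
have -> : P %% Q = (P - M * Q) %% Q by rewrite modpD modpN modp_mull oppr0 addr0.
apply: IHn; last exact: overB.
apply: leq_trans Pn; rewrite -(prednK sP) ltnS.
apply/leq_sizeP => i; rewrite leq_eqVlt => /predU1P[<-|Pi].
  rewrite coefB -scalerAl coefZ coefXnM -lead_coefE.
  have -> : ((size P).-1 < size P - size Q)%N = false.
    by have := size_poly_gt0 Q; rewrite Q0; lia.
  have -> : ((size P).-1 - (size P - size Q))%N = (size Q).-1.
    by have := size_poly_gt0 Q; rewrite Q0; lia.
  by rewrite -[Q`__]lead_coefE (monicP mQ) mulr1 subrr.
rewrite nth_default//; apply: leq_trans (size_polyD _ _) _.
by rewrite size_polyN sM maxnn; move: Pi sP; lia.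
Qed.

End EulerTrace.


(** * Laurent series *)

Section FrobeniusRoots.

Lemma poly_pth_power (A : idomainType) (p : nat) (f : {poly A}) :
  p \in [pchar A] -> f^`() = 0 -> (forall i, exists b, b ^+ p = f`_i) ->
  exists h, h ^+ p = f.
Proof.
move=> chA f'0 roots; have p0 := prime_gt0 (pcharf_prime chA).
have chX : p \in [pchar {poly A}] by rewrite pchar_poly.
have fn0 n : ~~ (p %| n)%N -> f`_n = 0.
  case: n => [|n]; first by rewrite dvdn0.
  rewrite (dvdn_pcharf chA) => n0; have /eqP := congr1 (fun g : {poly A} => g`_n) f'0.
  by rewrite coef_deriv coef0 -mulr_natr mulf_eq0 (negbTE n0) orbF => /eqP.
have [b bP] := choice roots.
exists (\sum_(i < size f) b (i * p)%N *: 'X^i).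
rewrite -(pFrobenius_autE chX) rmorph_sum /=.
apply/polyP => n; rewrite coef_sum.
under eq_bigr => i _.
  rewrite pFrobenius_autE exprZn bP -exprM coefZ coefXn; over.
have [/dvdnP[k ->]|pn] := boolP (p %| n)%N; last first.
  rewrite fn0// big1// => i _; case: eqP => [ni|_]; last by rewrite mulr0.
  by move: pn; rewrite ni dvdn_mull.
have [kf|fk] := ltnP k (size f).
  rewrite (bigD1 (Ordinal kf)) //= eqxx mulr1 big1 ?addr0// => i ik.
  rewrite eqn_pmul2r//; case: eqP => [ki|_]; last by rewrite mulr0.
  by case/eqP: ik; exact/val_inj.
rewrite [RHS]nth_default; last by apply: leq_trans fk _; rewrite leq_pmulr.
rewrite big1// => i _; rewrite eqn_pmul2r//; case: eqP => [ki|_]; last by rewrite mulr0.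
by have := ltn_ord i; rewrite -ki ltnNge fk.
Qed.

Lemma finField_pth_power (F : finFieldType) (p : nat) (c : F) :
  p \in [pchar F] -> exists b, b ^+ p = c.
Proof.
move=> chF; have [g _ gK] := injF_bij (fmorph_inj (pFrobenius_aut chF)).
by exists (g c); rewrite -(pFrobenius_autE chF) gK.
Qed.

End FrobeniusRoots.

Section LaurentCoefficients.
Variable F : fieldType.
Implicit Types (x y : laurent F) (M N n : int).

Lemma lmul_coef x y M N (m : nat) : bounded_above x M -> bounded_above y N ->
  (x * y) (M + N - m%:Z) = \sum_(i < m.+1) x (M - i%:Z) * y (N - (m - i)%N%:Z).
Proof.
move=> xM yN; rewrite [LHS](@lconvE _ _ _ _ _ _ m.+1)// coefM.
by apply: eq_bigr => i _; rewrite !coef_poly ltn_ord ltnS leq_subr.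
Qed.

Lemma bounded_mul x y M N : bounded_above x M -> bounded_above y N ->
  bounded_above (x * y) (M + N).
Proof. exact: lconv_bounded. Qed.

Lemma mulXn_coef (m : nat) y n : (poly_laurent 'X^m * y) n = y (n - m%:Z).
Proof.
have T0 (j : int) : j != m%:Z -> poly_laurent ('X^m : {poly F}) j = 0.
  by case: j => [k|k] // km; rewrite /= coefXn; case: eqP => // kE; rewrite kE eqxx in km.
have Tb : bounded_above (poly_laurent ('X^m : {poly F})) m%:Z.
  by move=> j mj; apply: T0; rewrite gt_eqF.
have [N yN] := laurent_bound y.
have [nN|Nn] := leP n (m%:Z + N); last first.
  by rewrite (bounded_mul Tb yN)// yN//; lia.
pose k := m%:Z + N - n; have -> : n = m%:Z + N - `|k|%N%:Z by rewrite /k; lia.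
rewrite (lmul_coef _ Tb yN) big_ord_recl big1 => [|i _]; last first.
  by rewrite T0 ?mul0r//= /bump; lia.
rewrite addr0 subr0 /= coefXn eqxx mul1r subn0; congr (y _); lia.
Qed.

Lemma bounded_sub x y N : bounded_above x N -> bounded_above y N ->
  bounded_above (x - y) N.
Proof. by move=> xN yN n Nn; rewrite /= xN// yN// subr0. Qed.

Fact lderiv_subproof x : exists N, bounded_above (fun n => x (n + 1) *~ (n + 1)) N.
Proof.
have [N xN] := laurent_bound x.
by exists N => n Nn; rewrite xN ?mul0rz// ltr_wpDr.
Qed.
Definition lderiv x := mkLaurent (lderiv_subproof x).

Lemma lderivD x y : lderiv (x + y) = lderiv x + lderiv y.
Proof. by apply: laurent_ext => n; rewrite /= mulrzDl. Qed.

Lemma lderivM x y : lderiv (x * y) = lderiv x * y + x * lderiv y.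
Proof.
have [M xM] := laurent_bound x; have [N yN] := laurent_bound y.
have dB (z : laurent F) K : bounded_above z K -> bounded_above (lderiv z) (K - 1).
  by move=> zK n Kn; rewrite /= zK ?mul0rz//; lia.
have dE (z : laurent F) K (i : nat) : lderiv z (K - 1 - i%:Z) = z (K - i%:Z) *~ (K - i%:Z).
  by rewrite /= (_ : K - 1 - i%:Z + 1 = K - i%:Z)//; lia.
apply: (@laurent_ext_le _ _ _ (M + N - 1)) => [||m].
- by apply: dB; exact: bounded_mul.
- move=> n nN; rewrite /= [lconv _ _ _](@bounded_mul (lderiv x) y (M - 1) N)//; last 2 first.
    exact: dB.
    lia.
  rewrite [lconv _ _ _](@bounded_mul x (lderiv y) M (N - 1))//; last 2 first.
    exact: dB.
    lia.
  by rewrite addr0.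
rewrite dE lmul_coef// -[RHS]/((lderiv x * y) _ + (x * lderiv y) _).
rewrite {1}(_ : M + N - 1 - m%:Z = (M - 1) + N - m%:Z); last lia.
rewrite {1}(_ : M + N - 1 - m%:Z = M + (N - 1) - m%:Z); last lia.
rewrite !lmul_coef//; try exact: dB.
rewrite -big_split mulrz_suml; apply: eq_bigr => i _.
rewrite !dE mulrzAl mulrzAr /= -mulrzDr; congr (_ *~ _).
by have := ltn_ord i; lia.
Qed.

Lemma lderiv_poly (c : {poly F}) : lderiv (poly_laurent c) = poly_laurent c^`().
Proof.
apply: laurent_ext => -[n|n] /=.
  have -> : n%:Z + 1 = n.+1%:Z by lia.
  by rewrite addn1 coef_deriv.
case: n => [|n]; first exact: mulr0z.
by rewrite (_ : Negz n.+1 + 1 = Negz n) ?mul0rz//; lia.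
Qed.

Local Notation lpoly := (map_poly (@poly_laurent F)).

Lemma lderiv_horner (P : {poly {poly F}}) x :
  lderiv (lpoly P).[x] = (lpoly (map_poly deriv P)).[x] + (lpoly P^`()).[x] * lderiv x.
Proof.
elim/poly_ind: P => [|P c IHP].
  rewrite !rmorph0 /= map_poly0 deriv0 !rmorph0 !horner0 mul0r addr0.
  by apply: laurent_ext => n; rewrite /= mul0rz.
have -> : map_poly deriv (P * 'X + c%:P) = map_poly deriv P * 'X + (c^`())%:P.
  apply/polyP => i; rewrite !(coefD, coefMX, coefC, coef_map_id0) ?deriv0//.
  by rewrite derivD; case: i => [|i] //=; rewrite ?coef_map_id0 ?deriv0.
rewrite derivD derivM derivX derivC addr0 mulr1.
rewrite !rmorphD !rmorphM /= !map_polyX !map_polyC /= !hornerE.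
rewrite lderivD lderivM IHP lderiv_poly; ring.
Qed.

End LaurentCoefficients.

Section Separability.
Variable F : finFieldType.
Variables (alpha : laurent F) (P : {poly {poly F}}).
Local Notation lpoly := (map_poly (@poly_laurent F)).
Hypothesis P_monic : P \is monic.
Hypothesis P_alpha : (lpoly P).[alpha] = 0.
Hypothesis P_min : forall H, (lpoly H).[alpha] = 0 -> (size H < size P)%N -> H = 0.

(* If [P' = 0], then applying [d/dt] to [P alpha = 0] makes all coefficients of
   [P] constants of the derivation, so that [P] is a [p]-th power. *)
Lemma minimal_separable : (lpoly P^`()).[alpha] != 0.
Proof.
have P0 := monic_neq0 P_monic.
apply/negP => /eqP P'a; have P'0 : P^`() = 0 by apply: P_min P'a _; exact: lt_size_deriv.
have D0 : map_poly deriv P = 0.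
  apply: P_min.
    have := lderiv_horner P alpha; rewrite P_alpha P'0 rmorph0 horner0 mul0r addr0 => <-.
    by apply: laurent_ext => n; rewrite /= mul0rz.
  rewrite -[X in (_ < X)%N](@prednK (size P)) ?size_poly_gt0// ltnS.
  apply/leq_sizeP => i; rewrite leq_eqVlt coef_map_id0 ?deriv0// => /predU1P[<-|Pi].
    by rewrite -lead_coefE (monicP P_monic) derivC.
  by rewrite nth_default ?deriv0// -(@prednK (size P)) ?size_poly_gt0.
have [p p_prime chF] := finPcharP F.
have chA : p \in [pchar {poly F}] by rewrite pchar_poly.
have [i|H HP] := poly_pth_power chA P'0.
  apply: poly_pth_power => // [|j]; last exact: finField_pth_power.
  have := congr1 (fun Q : {poly {poly F}} => Q`_i) D0.
  by rewrite coef_map_id0 ?deriv0// coef0.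
have Ha : (lpoly H).[alpha] = 0.
  by apply/eqP; have := P_alpha; rewrite -HP rmorphXn /= horner_exp => /eqP;
    rewrite expf_eq0 => /andP[].
have H0 : H != 0 by apply: contraNneq P0 => H0; rewrite -HP H0 expr0n; case: p p_prime {chF chA HP}.
case/eqP: H0; apply: P_min => //; rewrite -HP.
have sH : (1 < size H)%N.
  rewrite ltnNge; apply/negP => /size1_polyC HE.
  have : P = (H`_0 ^+ p)%:P by rewrite -HP HE rmorphXn /= coefC.
  move=> PE; move: P_alpha P_monic; rewrite PE map_polyC hornerC /= => /eqP.
  rewrite poly_laurent_eq0 => /eqP->.
  by rewrite monicE lead_coef0 eq_sym oner_eq0.
have := prime_gt1 p_prime; rewrite -(@prednK (size (H ^+ p))); last first.
  by rewrite HP size_poly_gt0.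
rewrite size_exp; move: sH; case: (size H) => [|[|n]] // _ p1 /=.
by rewrite ltnS -[X in (X < _)%N]muln1 ltn_pmul2l.
Qed.

End Separability.

Section Hensel.

Lemma strong_recursion (A : Type) (step : nat -> (nat -> A) -> A) (a0 : A) :
  (forall k s s', (forall i, (i < k)%N -> s i = s' i) -> step k s = step k s') ->
  exists s, forall k, s k = step k s.
Proof.
move=> stepE; pose it := fix it n : nat -> A :=
  if n is m.+1 then fun k => step k (it m) else fun=> a0.
have itE n m k : (k < n)%N -> (k < m)%N -> it n k = it m k.
  elim: n m k => [|n IHn] [|m] k // kn km; apply: stepE => i ik.
  by apply: IHn; apply: leq_trans ik _.
exists (fun k => it k.+1 k) => k /=; apply: stepE => i ik.
exact: (itE k i.+1 i ik (ltnSn i)).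
Qed.

Variable F : fieldType.

Lemma solve_coprime (r d : nat) (u e : {poly F}) : u`_0 != 0 ->
  (r <= d)%N -> (size u <= (d - r).+1)%N -> (size e <= d.+1)%N ->
  exists gh : {poly F} * {poly F}, [/\ 'X^r * gh.2 + gh.1 * u = e,
    (size gh.1 <= r)%N & (size gh.2 <= (d - r).+1)%N].
Proof.
move=> u0 rd su se.
have arith (m n : nat) : (m <= r)%N -> (n <= (d - r).+1)%N -> ((m + n).-1 <= d.+1)%N.
  by lia.
have X0 : 'X^r != 0 :> {poly F} by rewrite monic_neq0 ?monicXn.
have cop : coprimep 'X^r u.
  apply: coprimep_expl; rewrite coprimep_sym -['X]subr0 -polyC0.
  by rewrite coprimep_XsubC /root horner_coef0.
have /Bezout_eq1_coprimepP[[a b] /= ab] := cop.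
pose g := (e * b) %% 'X^r.
have sg : (size g <= r)%N by rewrite -ltnS -[X in (_ < X)%N](size_polyXn F) ltn_modp.
have /dvdpP[h hE] : 'X^r %| e - g * u.
  have -> : e - g * u = (e * a + ((e * b) %/ 'X^r) * u) * 'X^r.
    rewrite /g; have := divp_eq (e * b) 'X^r.
    set q := _ %/ _; set m := _ %% _ => E.
    have -> : m = e * b - q * 'X^r by rewrite E addrAC subrr add0r.
    rewrite -[in LHS](mulr1 e) -{1}ab; ring.
  exact: dvdp_mulIr.
exists (g, h); split=> //=; first by rewrite mulrC -hE subrK.
have sehu : (size (e - g * u)%R <= d.+1)%N.
  apply: leq_trans (size_polyD _ _) _; rewrite geq_max se size_polyN.
  apply: leq_trans (size_polyMleq _ _) _; exact: arith.
have [->|h0] := eqVneq h 0; first by rewrite size_poly0.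
move: sehu; rewrite hE size_Mmonic ?monicXn// size_polyXn addnS /=.
have : forall m : nat, (m + r <= d.+1)%N -> (m <= (d - r).+1)%N by lia.
exact.
Qed.

Lemma hensel_series (r d : nat) (f : nat -> {poly F}) (u : {poly F}) :
  f 0%N = 'X^r * u -> u`_0 != 0 -> (r <= d)%N -> (forall k, (size (f k) <= d.+1)%N) ->
  (size u <= (d - r).+1)%N ->
  exists g h : nat -> {poly F}, [/\ g 0%N = 'X^r,
    forall k, (0 < k)%N -> (size (g k) <= r)%N,
    forall k, (size (h k) <= (d - r).+1)%N &
    forall k, \sum_(i < k.+1) g i * h (k - i)%N = f k].
Proof.
move=> f0 u0 rd sf su.
have arith (m n : nat) : (m <= r.+1)%N -> (n <= (d - r).+1)%N -> ((m + n).-1 <= d.+1)%N.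
  by lia.
have /choice[sol solP] : forall e : {poly F}, exists gh : {poly F} * {poly F},
    (size e <= d.+1)%N -> [/\ 'X^r * gh.2 + gh.1 * u = e,
    (size gh.1 <= r)%N & (size gh.2 <= (d - r).+1)%N].
  move=> e; have [se|nse] := pselect (size e <= d.+1)%N; last by exists (0, 0).
  by have [gh ghP] := solve_coprime u0 rd su se; exists gh.
pose err k (s : nat -> {poly F} * {poly F}) :=
  f k - \sum_(1 <= i < k) (s i).1 * (s (k - i)%N).2.
pose step k s := if k == 0%N then ('X^r, u) else sol (err k s).
have [k s s' ss'|s sE] := strong_recursion (step := step) (0, 0).
  rewrite /step; case: eqP => // _; congr (sol (_ - _)).
  apply: eq_big_nat => i /andP[i1 ik]; rewrite !ss'//.
  by rewrite ltn_subrL i1 (leq_trans _ ik).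
have s0 : s 0%N = ('X^r, u) by rewrite sE.
have sz k : [/\ (0 < k)%N -> (size (s k).1 <= r)%N, (size (s k).2 <= (d - r).+1)%N &
    (size (s k).1 <= r.+1)%N].
  elim/ltn_ind: k => k IHk; rewrite sE /step; case: eqP => [->|/eqP k0] /=.
    by split; rewrite ?size_polyXn.
  have [|_ s1 s2] := solP (err k s); last by split=> //; exact: leqW.
  apply: leq_trans (size_polyD _ _) _; rewrite geq_max sf size_polyN.
  apply: leq_trans (size_sum _ _ _) _; apply/bigmax_leqP_seq => i.
  rewrite mem_index_iota => /andP[i1 ik] _.
  have [_ _ a1] := IHk _ ik.
  have [|_ a2 _] := IHk (k - i)%N; first by rewrite ltn_subrL i1 (leq_trans _ ik).
  apply: leq_trans (size_polyMleq _ _) _; exact: arith.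
exists (fun k => (s k).1), (fun k => (s k).2); split.
- by rewrite s0.
- by move=> k; case: (sz k).
- by move=> k; case: (sz k).
case=> [|k]; first by rewrite big_ord1 /= s0.
rewrite big_ord_recl big_ord_recr /= subn0 subnn s0 /= /bump /=.
have se : (size (err k.+1 s) <= d.+1)%N.
  apply: leq_trans (size_polyD _ _) _; rewrite geq_max sf size_polyN.
  apply: leq_trans (size_sum _ _ _) _; apply/bigmax_leqP_seq => i _ _.
  have [_ _ a1] := sz i; have [_ a2 _] := sz (k.+1 - i)%N.
  apply: leq_trans (size_polyMleq _ _) _; exact: arith.
have [E _ _] := solP _ se.
have := sE k.+1; rewrite /step /= => sk; rewrite -sk in E.
rewrite add1n addrCA E /err big_add1 /= big_mkord addrCA.
rewrite (eq_bigr (fun i : 'I_k => (s i.+1).1 * (s (k.+1 - i.+1)%N).2)).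
  by rewrite subrr addr0.
by move=> i _; rewrite add1n.
Qed.

End Hensel.

Section NewtonPolygon.
Variable F : fieldType.
Implicit Types (f g h : {poly (laurent F)}) (N : int).

Fact ltail_subproof N (c : nat -> F) :
  exists M, bounded_above (fun n => if n <= N then c `|N - n|%N else 0) M.
Proof. by exists N => n Nn; rewrite leNgt Nn. Qed.
Definition ltail N (c : nat -> F) : laurent F := mkLaurent (ltail_subproof N c).

Lemma ltail_bounded N c : bounded_above (ltail N c) N.
Proof. by move=> n Nn; rewrite /= leNgt Nn. Qed.

Lemma ltailE N c (k : nat) : ltail N c (N - k%:Z) = c k.
Proof.
rewrite /= ifT; last lia.
by congr c; lia.
Qed.

Lemma ltail0 N c : (forall k, c k = 0) -> ltail N c = 0.
Proof. by move=> c0; apply: laurent_ext => n /=; case: ifP. Qed.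

Lemma lcoef_sum (I : Type) (s : seq I) (P : pred I) (x : I -> laurent F) n :
  (\sum_(i <- s | P i) x i) n = \sum_(i <- s | P i) x i n.
Proof. exact: (big_morph (fun y : laurent F => y n)). Qed.

Lemma hensel_factor (r d : nat) f N : size f = d.+1 ->
  (forall i, bounded_above f`_i N) -> (0 < r < d)%N ->
  (forall i, (i < r)%N -> f`_i N = 0) -> f`_r N != 0 -> ~ irreducible_poly f.
Proof.
move=> sf fN /andP[r0 rd] low fr.
pose Fk (k : nat) : {poly F} := \poly_(i < d.+1) f`_i (N - k%:Z).
pose u : {poly F} := \poly_(i < (d - r).+1) f`_(i + r) N.
have [|||||g [h [g0 sg sh gh]]] := @hensel_series F r d Fk u.
- apply/polyP => i; rewrite coefXnM !coef_poly subr0.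
  have [ir|ri] := ltnP i r; first by rewrite low// if_same.
  have -> : (i - r < (d - r).+1)%N = (i < d.+1)%N by lia.
  by rewrite subnK.
- by rewrite coef_poly add0n.
- exact: ltnW.
- by move=> k; exact: size_poly.
- exact: size_poly.
move=> [f1 irr].
pose gL := \poly_(i < r.+1) ltail 0 (fun k => (g k)`_i).
pose hL := \poly_(i < (d - r).+1) ltail N (fun k => (h k)`_i).
have sgr k : (size (g k) <= r.+1)%N.
  by case: k => [|k]; [rewrite g0 size_polyXn|apply: leqW; exact: sg].
have gE i : gL`_i = ltail 0 (fun k => (g k)`_i).
  rewrite coef_poly; case: ltnP => // ri; rewrite ltail0// => k.
  by rewrite nth_default//; exact: leq_trans ri.
have hE i : hL`_i = ltail N (fun k => (h k)`_i).
  rewrite coef_poly; case: ltnP => // ri; rewrite ltail0// => k.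
  by rewrite nth_default//; exact: leq_trans ri.
have fE : gL * hL = f.
  apply/polyP => m; apply: (@laurent_ext_le _ _ _ N) => // [|k].
    rewrite coefM => n Nn; rewrite lcoef_sum big1// => i _; rewrite gE hE.
    by apply: (@bounded_mul _ _ _ 0 N); rewrite ?add0r//; exact: ltail_bounded.
  rewrite coefM lcoef_sum.
  transitivity (\sum_(i < m.+1) \sum_(j < k.+1) (g j)`_i * (h (k - j)%N)`_(m - i)).
    apply: eq_bigr => i _; rewrite gE hE -[N in _ (N - _)]add0r.
    rewrite lmul_coef; [|exact: ltail_bounded|exact: ltail_bounded].
    by apply: eq_bigr => j _; rewrite !ltailE.
  rewrite exchange_big /=; under eq_bigr do rewrite -coefM.
  rewrite -coef_sum gh coef_poly; case: ltnP => // dm.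
  by rewrite nth_default ?sf.
have sgL : size gL = r.+1.
  apply/eqP; rewrite eqn_leq size_poly /= ltnNge; apply/negP => /leq_sizeP/(_ r (leqnn r)).
  rewrite gE => /(congr1 (fun x : laurent F => x (0 - 0%N%:Z))).
  by rewrite ltailE g0 coefXn eqxx => /eqP; rewrite oner_eq0.
have /irr : size gL != 1%N by rewrite sgL eqSS -lt0n.
rewrite -{1}fE dvdp_mulr// => /(_ isT) /eqp_size; rewrite sgL sf => -[rd'].
by move: rd; rewrite rd' ltnn.
Qed.

Lemma irreducible_small_coefs f : f \is monic -> irreducible_poly f ->
  bounded_above f`_0 (-1) ->
  forall i, (i < (size f).-1)%N -> bounded_above f`_i (-1).
Proof.
move=> mf irr f0.
have f1 : (1 < size f)%N by case: irr.
pose d := (size f).-1; have sf : size f = d.+1 by rewrite prednK// ltnW.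
have fd : f`_d = 1 by move: mf; rewrite monicE lead_coefE => /eqP.
have exN : exists N : nat, `[< forall i, bounded_above f`_i N%:Z >].
  have [N NP] : exists N : nat, forall i, (i < size f)%N -> bounded_above f`_i N%:Z.
    elim: (size f) => [|s [N NP]]; first by exists 0%N.
    have [M MP] := laurent_bound f`_s; exists (N + `|M|)%N => i.
    rewrite ltnS leq_eqVlt => /predU1P[->|/NP]; apply: bounded_above_le => //; last lia.
    by apply: bounded_above_le MP; lia.
  exists N; apply/asboolP => i; have [/NP//|si] := ltnP i (size f).
  by rewrite nth_default.
case: (ex_minnP exN) => N /asboolP NP minN.
apply: contrapT => /existsNP[i0 /not_implyP[i0d ni0]].
have exr : exists r, (r < d)%N && (f`_r N%:Z != 0).
  case: N NP minN => [|N] NP minN.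
    exists i0; rewrite i0d /=; apply: contra_notN ni0 => /eqP z n n1.
    by have [->//|n0] := eqVneq n 0; apply: NP; lia.
  apply: contrapT => /forallNP nr.
  suff /minN : `[< forall i, bounded_above f`_i N%:Z >] by rewrite ltnn.
  apply/asboolP => i n Nn.
  have [E|nN] := eqVneq n N.+1%:Z; last by apply: NP; lia.
  rewrite E; have [id|di|->] := ltngtP i d.
  - by apply/eqP; have /negP := nr i; rewrite id /= negbK.
  - by rewrite nth_default// sf.
  - by rewrite fd /=.
case: (ex_minnP exr) => r /andP[rd fr] minr.
have r0 : (0 < r)%N.
  by rewrite lt0n; apply: contraNneq fr => ->; rewrite f0//; lia.
apply: (hensel_factor sf NP _ _ fr irr); first by rewrite r0.
move=> i ir; apply/eqP; apply: contraTT ir => fi; rewrite -leqNgt.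
have [id|di] := ltnP i d; first by apply: minr; rewrite id.
exact: leq_trans (ltnW rd) di.
Qed.

End NewtonPolygon.


(** * Pisot elements *)

Lemma char_poly_trmx (R : comNzRingType) n (A : 'M[R]_n) :
  char_poly A^T = char_poly A.
Proof.
rewrite /char_poly -det_tr /char_poly_mx linearB /= tr_scalar_mx.
by rewrite -map_trmx trmxK.
Qed.

Section NormOfGenerator.
Variables (K : fieldType) (L : fieldExtType K) (f : {poly K}) (z : L).
Hypotheses (f_monic : f \is monic) (f_irr : irreducible_poly f).
Hypothesis fz : root (map_poly (in_alg L) f) z.

Lemma irreducible_dvd_root (g : {poly K}) :
  root (map_poly (in_alg L) g) z -> f %| g.
Proof.
move=> gz; apply: contraT; rewrite -irreducible_poly_coprime// => cfg.
have : coprimep (map_poly (in_alg L) f) (map_poly (in_alg L) g).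
  by rewrite coprimep_map.
by move/coprimep_root/(_ fz); rewrite -/(root _ z) gz.
Qed.

Lemma field_norm_generator : \dim (<<1; z>>%AS : {subfield L}) = (size f).-1 ->
  field_norm <<1; z>>%AS z = (-1) ^+ (size f).-1 * f`_0.
Proof.
rewrite /field_norm; set E := <<1; z>>%AS; move=> dimE.
set A := \matrix_(i, j) _.
have bE : <<vbasis E>>%VS = E :> {vspace L} := span_basis (vbasisP E).
have zE : z \in E by exact: memv_adjoin.
pose v : 'rV[L]_(\dim E) := \row_j (vbasis E)`_j.
have v0 : v != 0.
  have d0 : (0 < \dim E)%N.
    by rewrite dimE -ltnS prednK; case: f_irr => // /ltnW.
  apply/eqP => /rowP/(_ (Ordinal d0)); rewrite !mxE /= => b0.
  have b0E : (vbasis E)`_0 \in (vbasis E : seq L) by rewrite mem_nth ?size_tuple.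
  have := free_not0 (basis_free (vbasisP E)) b0E.
  by rewrite b0 eqxx.
have Av : v *m (map_mx (in_alg L) A)^T = z *: v.
  apply/rowP => i; rewrite !mxE.
  have bi : z * (vbasis E)`_i \in <<vbasis E>>%VS.
    by rewrite bE rpredM// vbasis_mem// mem_nth// size_tuple.
  rewrite [RHS](coord_span bi); apply: eq_bigr => j _.
  by rewrite !mxE mulr_algr.
have rz : root (map_poly (in_alg L) (char_poly A)) z.
  rewrite map_char_poly /root -char_poly_trmx -/(root _ z) -eigenvalue_root_char.
  by apply/eigenvalueP; exists v.
have fchar : char_poly A = f.
  have := irreducible_dvd_root rz.
  move=> fd; apply/esym/eqP; rewrite -eqp_monic ?char_poly_monic//.
  rewrite -dvdp_size_eqp// size_char_poly dimE prednK//.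
  by case: f_irr => /ltnW.
have := char_poly_det A; rewrite fchar => ->.
by rewrite -dimE mulrA -expr2 sqrr_sign mul1r.
Qed.

End NormOfGenerator.

Section PisotFactors.
Variables (R : realType) (F : finFieldType) (alpha : laurent F).
Hypothesis alpha_PV : PV_element R alpha.

Lemma laurent_abs_lt1 (x : laurent F) : laurent_abs R x < 1 -> bounded_above x (-1).
Proof.
have [->//|x0] := eqVneq x 0.
rewrite /laurent_abs (negbTE x0) => x1; have [_ xb] := ldegP x0.
apply: bounded_above_le xb; rewrite -ltzD1 addNr ltNge; apply: contraTN x1 => d0.
rewrite -leNgt; case: (ldeg x) d0 => // n _; rewrite -exprnP exprn_ege1// ler1n.
by apply/card_gt0P; exists 0.
Qed.

Lemma bounded_opp (x : laurent F) N : bounded_above x N -> bounded_above (- x) N.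
Proof. by move=> xN n Nn; rewrite /= xN// oppr0. Qed.

Lemma pisot_factor_coefs (p : {poly {fraction {poly F}}}) (f : {poly laurent F}) :
  irreducible_poly p -> root (map_poly (@frac_laurent F) p) alpha ->
  f \is monic -> irreducible_poly f -> f %| map_poly (@frac_laurent F) p ->
  ~~ root f alpha ->
  forall i, (i < (size f).-1)%N -> bounded_above f`_i (-1).
Proof.
move=> irrp pa mf irrf fp fa; apply: irreducible_small_coefs => //.
have [L dimL [z fz zfull]] := irredp_FAdjoin irrf.
have [_ _ conj1] := alpha_PV.
have dimE : \dim (<<1; z>>%AS : {subfield L}) = (size f).-1 by rewrite -dimL -zfull.
have cz : conjugate alpha z.
  exists p; split=> //; rewrite map_poly_comp.
  by apply: root_dvdp fz; rewrite dvdp_map.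
have za : z <> alpha%:A.
  by move=> zE; move: fz; rewrite zE fmorph_root (negbTE fa).
have := conj1 L z cz za; rewrite /ext_abs (field_norm_generator mf irrf fz dimE) => nz.
have := laurent_abs_lt1 (x := (-1) ^+ (size f).-1 * f`_0).
have lt1 : laurent_abs R ((-1) ^+ (size f).-1 * f`_0) < 1.
  rewrite ltNge; apply: contraTN nz => n1; rewrite -leNgt.
  apply: (@le_trans _ _ (1 `^ (adjoin_degree 1 z)%:R^-1)); first by rewrite powR1.
  by rewrite ge0_ler_powR ?invr_ge0// nnegrE// (le_trans ler01).
move/(_ lt1); rewrite -signr_odd; case: odd; rewrite ?mul1r// mulN1r.
by move/bounded_opp; rewrite opprK.
Qed.

(* Nonleading coefficients in the maximal ideal are inherited by products. *)
Lemma pisot_cofactor_coefs (p : {poly {fraction {poly F}}}) (Q : {poly laurent F}) :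
  irreducible_poly p -> root (map_poly (@frac_laurent F) p) alpha ->
  Q \is monic -> Q %| map_poly (@frac_laurent F) p -> ~~ root Q alpha ->
  forall i, (i < (size Q).-1)%N -> bounded_above Q`_i (-1).
Proof.
move=> irrp pa; have [n] := ubnP (size Q); elim: n Q => // n IHn Q /ltnSE Qn mQ Qp Qa.
have Q0 := monic_neq0 mQ.
have [Q1|Q1] := leqP (size Q) 1.
  by move=> i; case: (size Q) Q1 => [|[|]].
have [f [irrf mf fQ]] := irreducible_factor Q1.
have /dvdpP[g gE] := fQ.
have mg : g \is monic by rewrite -(monicMr _ mf) -gE.
have g0 := monic_neq0 mg; have f0 := monic_neq0 mf.
have sf : (1 < size f)%N by case: irrf.
have sQ : (size Q).-1 = ((size g).-1 + (size f).-1)%N.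
  rewrite gE size_mul//; have : (0 < size g)%N by rewrite size_poly_gt0.
  have : forall a b : nat, (0 < a)%N -> (1 < b)%N -> (a + b).-1.-1 = (a.-1 + b.-1)%N by lia.
  by move=> H g1; exact: H.
have fa : ~~ root f alpha by apply: contra Qa; exact: root_dvdp.
have ga : ~~ root g alpha.
  by apply: contra Qa => ga; apply: root_dvdp ga; rewrite gE dvdp_mulr.
have small_f := pisot_factor_coefs irrp pa mf irrf (dvdp_trans fQ Qp) fa.
have gQ : g %| Q by rewrite gE dvdp_mulr.
have small_g : forall i, (i < (size g).-1)%N -> bounded_above g`_i (-1).
  apply: IHn => //; last exact: dvdp_trans gQ Qp.
  apply: leq_trans Qn; rewrite gE mulrC size_dvdp_lt//.
have ft : f`_(size f).-1 = 1 by rewrite -lead_coefE (monicP mf).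
have gt : g`_(size g).-1 = 1 by rewrite -lead_coefE (monicP mg).
have all0 (q : {poly laurent F}) i : (forall i, (i < (size q).-1)%N -> bounded_above q`_i (-1)) ->
    q`_(size q).-1 = 1 -> bounded_above q`_i 0.
  move=> qs qt; have [iq|qi|->] := ltngtP i (size q).-1.
  - by apply: bounded_above_le (qs _ iq).
  - by rewrite nth_default//; case: (size q) qi.
  - by rewrite qt => k k0; rewrite /= gt_eqF.
move=> i; rewrite sQ => isz k k1; rewrite gE coefM lcoef_sum big1// => j _.
have [jg|gj] := ltnP j (size g).-1.
  by apply: (@bounded_mul _ _ _ (-1) 0) => //; [exact: small_g|exact: all0].
have ij : (i - j < (size f).-1)%N.
  have := ltn_ord j; rewrite ltnS => ji; rewrite ltn_subLR//.
  by apply: leq_trans isz _; rewrite leq_add2r.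
by apply: (@bounded_mul _ _ _ 0 (-1)) => //; [exact: all0|exact: small_f].
Qed.

End PisotFactors.

Lemma minimal_polynomial (K E : fieldType) (iota : {rmorphism K -> E}) (a : E)
    (p0 : {poly K}) : p0 != 0 -> root (map_poly iota p0) a ->
  exists p, [/\ p \is monic, irreducible_poly p, root (map_poly iota p) a &
    forall q, root (map_poly iota q) a -> p %| q].
Proof.
move=> p00 p0a.
have ex : exists n : nat, `[< exists p : {poly K},
    [/\ p != 0, root (map_poly iota p) a & size p = n] >].
  by exists (size p0); apply/asboolP; exists p0.
case: (ex_minnP ex) => n /asboolP[p1 [p10 p1a <-]] minn1.
pose p := (lead_coef p1)^-1 *: p1.
have lc0 : (lead_coef p1)^-1 != 0 by rewrite invr_eq0 lead_coef_eq0.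
have mp : p \is monic by rewrite monicE lead_coefZ mulVf// lead_coef_eq0.
have pa : root (map_poly iota p) a by rewrite map_polyZ rootZ// fmorph_eq0.
have minp (q : {poly K}) : q != 0 -> root (map_poly iota q) a -> (size p <= size q)%N.
  move=> q0 qa; rewrite size_scale//; apply: minn1.
  by apply/asboolP; exists q.
have pn0 := monic_neq0 mp.
exists p; split=> //.
  split.
    rewrite ltnNge; apply/negP => /size1_polyC pc.
    by move: pa mp; rewrite pc map_polyC rootC fmorph_eq0 => /eqP->;
      rewrite monicE lead_coef0 eq_sym oner_eq0.
  move=> q q1 qp; have /dvdpP[g gE] := qp.
  have q0 : q != 0 by apply: contraNneq pn0 => q0; rewrite gE q0 mulr0.
  have g0 : g != 0 by apply: contraNneq pn0 => g0; rewrite gE g0 mul0r.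
  move: pa; rewrite gE rmorphM rootM => /orP[/(minp _ g0)|/(minp _ q0)]; last first.
    by move=> pq; rewrite -gE -dvdp_size_eqp// eqn_leq dvdp_leq.
  rewrite leqNgt gE mulrC size_dvdp_lt//.
  by rewrite ltn_neqAle eq_sym q1 size_poly_gt0.
move=> q qa; rewrite /dvdp; apply: contraT => r0.
have : (size p <= size (q %% p)%R)%N.
  apply: minp => //; move: qa; rewrite {1}(divp_eq q p).
  by rewrite rmorphD rmorphM rootE hornerD hornerM (rootP pa) mulr0 add0r.
by rewrite leqNgt ltn_modp pn0.
Qed.

Section PisotMinimalPolynomial.
Variables (R : realType) (F : finFieldType) (alpha : laurent F).
Local Notation Z := {poly F}.
Local Notation frac_poly := (map_poly (@FracField.tofrac Z)).
Local Notation lpoly := (map_poly (@poly_laurent F)).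
Local Notation flpoly := (map_poly (@frac_laurent F)).

Lemma frac_laurent_tofrac (c : Z) :
  frac_laurent (FracField.tofrac c) = poly_laurent c.
Proof.
unlock FracField.tofrac.
by rewrite frac_laurent_pi !numden_Ratio ?oner_eq0// rmorph1 divr1.
Qed.

Lemma flpoly_frac (P : {poly Z}) : flpoly (frac_poly P) = lpoly P.
Proof. by rewrite -map_poly_comp; apply: eq_map_poly => c; exact: frac_laurent_tofrac. Qed.

Lemma pisot_minimal : integralOver (@poly_laurent F) alpha ->
  exists P : {poly Z}, [/\ P \is monic, root (lpoly P) alpha,
    irreducible_poly (frac_poly P) &
    forall H : {poly Z}, root (lpoly H) alpha -> (size H < size P)%N -> H = 0].
Proof.
move=> [P0 mP0 P0a].
have p00 : frac_poly P0 != 0 by apply: monic_neq0; rewrite frac_poly_monic.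
have p0a : root (flpoly (frac_poly P0)) alpha by rewrite flpoly_frac.
have [p [mp irrp pa minp]] := minimal_polynomial p00 p0a.
have pP0 := minp _ p0a.
have /dvdpP[q qE] := pP0.
have mq : q \is monic by rewrite -(monicMr _ mp) -qE frac_poly_monic.
have [P mP PE] := gauss_monic mp mq (esym (etrans qE (mulrC _ _))).
exists P; split=> //; rewrite -?PE//; first by rewrite -flpoly_frac -PE.
move=> H Ha sH; apply/eqP; apply: contraT => H0.
have : (size p <= size (frac_poly H))%N.
  apply: dvdp_leq; last by apply: minp; rewrite flpoly_frac.
  by rewrite -(rmorph0 frac_poly) (inj_eq (@frac_poly_inj F)).
rewrite PE !size_map_inj_poly ?rmorph0//; try exact: tofrac_inj.
by rewrite leqNgt sH.
Qed.

Hypothesis alpha_PV : PV_element R alpha.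

Lemma pisot_factorization :
  exists (P : {poly Z}) (Q : {poly laurent F}),
  [/\ P \is monic, P`_0 != 0, Q \is monic, lpoly P = ('X - alpha%:P) * Q &
    forall i, (i < (size Q).-1)%N -> bounded_above Q`_i (-1)].
Proof.
have [nconst int_alpha _] := alpha_PV.
have [P [mP Pa irrP minP]] := pisot_minimal int_alpha.
have P'a := minimal_separable mP (rootP Pa) (fun H Ha => minP H (introT rootP Ha)).
have /factor_theorem[Q PQ] := Pa; rewrite mulrC in PQ.
have mPL : lpoly P \is monic by exact: monic_map.
have mQ : Q \is monic by rewrite -(monicMr _ (monicXsubC alpha)) mulrC -PQ.
have Qa : ~~ root Q alpha.
  apply: contra P'a => Qa; rewrite -deriv_map PQ derivM derivXsubC mul1r hornerD hornerM.
  by rewrite (rootP Qa) hornerXsubC subrr mul0r addr0.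
have P0 : P`_0 != 0.
  apply/eqP => P0; have /factor_theorem[H] : root P 0.
    by rewrite /root horner_coef0 P0.
  rewrite polyC0 subr0 => HE.
  have H0 : H != 0 by apply: contraNneq (monic_neq0 mP) => H0; rewrite HE H0 mul0r.
  case/eqP: (H0); apply: minP; last by rewrite HE size_mulX.
  have := Pa; rewrite HE rmorphM /= map_polyX rootM => /orP[//|].
  rewrite /root hornerX => /eqP a0; case: (nconst 0).
  by rewrite a0 polyC0 rmorph0.
exists P, Q; split=> //.
apply: (pisot_cofactor_coefs alpha_PV irrP) => //; first by rewrite flpoly_frac.
by rewrite flpoly_frac PQ dvdp_mull.
Qed.

Lemma pisot_unbounded : ~ bounded_above alpha 0.
Proof.
move=> ab; have [nconst _ _] := alpha_PV.
have [P [Q [mP P0 mQ PQ Qsmall]]] := pisot_factorization.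
have E : poly_laurent P`_0 = - alpha * Q`_0.
  by rewrite -coef_map PQ coef0M coefB coefX coefC sub0r.
have [Q1|Q1] := leqP (size Q) 1.
  have Q01 : Q`_0 = 1.
    have := monic_neq0 mQ; move: mQ; rewrite monicE lead_coefE -size_poly_gt0.
    by move: Q1; case: (size Q) => [|[|]] // _ /eqP.
  rewrite Q01 mulr1 in E.
  apply: (nconst (- (P`_0)`_0)); rewrite polyCN rmorphN; apply: (canRL opprK); rewrite -E.
  apply: laurent_ext => -[[|n]|n] /=; rewrite ?coefC//.
  have -> : (P`_0)`_n.+1 = poly_laurent P`_0 n.+1%:Z by [].
  by rewrite E /= ab ?oppr0.
have Q0 : bounded_above Q`_0 (-1) by apply: Qsmall; case: (size Q) Q1 => [|[|]].
have : bounded_above (poly_laurent P`_0) (-1).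
  by rewrite E; apply: (@bounded_mul _ _ _ 0 (-1)) => //; exact: bounded_opp.
move=> Pb; case/eqP: P0; apply/polyP => i; rewrite coef0.
exact: (Pb i%:Z).
Qed.

Lemma pisot_coef_eventually0 : exists n0, forall n, (n0 <= n)%N -> (alpha ^+ n) (-1) = 0.
Proof.
have [P [Q [mP P0 mQ PQ Qsmall]]] := pisot_factorization.
pose e := (size Q).-1; have Q0 := monic_neq0 mQ.
have sQ : size Q = e.+1 by rewrite prednK// size_poly_gt0.
exists (2 * e)%N => n en.
have := trace_mulXsubC alpha 'X^n mQ; rewrite -PQ hornerXn => tr.
have : (trace (lpoly P) 'X^n) (-1) = (alpha ^+ n) (-1) + (trace Q 'X^n) (-1) by rewrite tr.
have -> : trace (lpoly P) 'X^n (-1) = 0.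
  pose S (x : laurent F) := exists c, x = poly_laurent c.
  have : S (trace (lpoly P) 'X^n).
    apply: over_modp.
    - by exists 0; rewrite rmorph0.
    - by move=> _ _ [c ->] [c' ->]; exists (c - c'); rewrite rmorphB.
    - by move=> _ _ [c ->] [c' ->]; exists (c * c'); rewrite rmorphM.
    - by exact: monic_map.
    - by move=> i; rewrite coef_map; exists P`_i.
    - move=> i; rewrite -(map_polyXn (@poly_laurent F)) deriv_map -rmorphM coef_map.
      by eexists.
  by case=> c ->.
have -> : trace Q 'X^n (-1) = 0; last by rewrite addr0 => <-.
pose O (x : laurent F) := bounded_above x 0.
have O0 : O 0 by [].
have OB x y : O x -> O y -> O (x - y) by exact: bounded_sub.
have OM x y : O x -> O y -> O (x * y) by move=> Ox Oy; apply: (@bounded_mul _ _ _ 0 0).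
have OQ : over O Q.
  move=> i; have [iq|qi|->] := ltngtP i (size Q).-1.
  - by apply: bounded_above_le (Qsmall _ iq).
  - by rewrite nth_default// sQ.
  - by rewrite -lead_coefE (monicP mQ) => k k0; rewrite /= gt_eqF.
pose T : laurent F := poly_laurent 'X^2.
have OT (x : laurent F) : bounded_above x (-1) -> bounded_above (poly_laurent 'X * x) 0.
  move=> xb; apply: (@bounded_mul _ _ _ 1 (-1)) => // -[k|k] // k1.
  by rewrite /= coefX; case: k k1 => [|[|]].
pose q1 := poly_laurent 'X *: ('X^e - Q).
have Oq1 : over O q1.
  move=> i; rewrite coefZ coefB coefXn; apply: OT.
  have [->|ie] := eqVneq i e.
    by rewrite -[Q`_e]lead_coefE (monicP mQ) subrr.
  rewrite sub0r; apply: bounded_opp.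
  have [iq|qi] := ltnP i e; first exact: Qsmall.
  by rewrite nth_default// sQ ltn_neqAle eq_sym ie.
have Xe : 'X^n = 'X^e * 'X^e * 'X^(n - 2 * e) :> {poly laurent F}.
  by rewrite -!exprD addnn -mul2n subnKC.
pose w := q1 * q1 * ('X^(n - 2 * e) * Q^`()).
have Ow : over O w.
  have OXn k : over O 'X^k.
    by move=> i; rewrite coefXn; case: eqP => // _ j j0; rewrite /= gt_eqF.
  have oM := overM O0 OB OM.
  apply: (oM); first exact: oM.
  apply: (oM); first exact: OXn.
  move=> i; rewrite coef_deriv -mulr_natr; apply: OM; first exact: OQ.
  elim: i.+1 => // k Ok; rewrite -natr1; apply: (closed_add O0 OB) => // j j0.
  by rewrite /= gt_eqF.
have wE : w %% Q = T *: ('X^n * Q^`() %% Q).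
  rewrite -modpZl; have -> : T *: ('X^n * Q^`()) = w + (T *: (('X^e * 2%:R - Q)
      * 'X^(n - 2 * e) * Q^`())) * Q.
    rewrite /w /q1 Xe -!mul_polyC /T expr2 rmorphM /= polyCM; ring.
  by rewrite modpD modp_mull addr0.
have := over_modp O0 OB OM mQ OQ Ow; rewrite wE => /(_ (size Q).-2).
rewrite coefZ -/(trace Q 'X^n); set x := trace _ _ => Tx.
by have := Tx 1 isT; rewrite mulXn_coef.
Qed.

End PisotMinimalPolynomial.

Section Coordinates.
Variable F : fieldType.
Implicit Types (x y : laurent F) (g : {poly F}).

Definition residue_coord (c : F) (y : laurent F) (g : {poly F}) : F :=
  c * (poly_laurent g * y) (-1).

Fact residue_coord_zmod c y : zmod_morphism (residue_coord c y).
Proof. by move=> g h; rewrite /residue_coord rmorphB mulrBl /= mulrBr. Qed.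

HB.instance Definition _ c y :=
  GRing.isZmodMorphism.Build {poly F} F (residue_coord c y) (residue_coord_zmod c y).

Lemma poly_bounded g : bounded_above (poly_laurent g) (size g)%:Z.
Proof. by move=> [k|k] //= gk; rewrite nth_default//; apply: ltnW. Qed.

Lemma int_part_bounded x : bounded_above (x - poly_laurent (int_part x)) (-1).
Proof.
move=> [k|k] // _; rewrite /= /int_part coef_poly; case: ltnP => [_|xk].
  by rewrite subrr.
rewrite subr0; have [->//|x0] := eqVneq x 0.
by have [_] := ldegP x0; apply; lia.
Qed.

Lemma bounded_expr x N k : bounded_above x N -> bounded_above (x ^+ k) (k%:Z * N).
Proof.
move=> xN; elim: k => [|k IHk]; first by rewrite mul0r => n n0; rewrite /= gt_eqF.
by rewrite exprS intS mulrDl mul1r; exact: bounded_mul.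
Qed.

Lemma expr_top x N k : bounded_above x N -> (x ^+ k) (k%:Z * N) = x N ^+ k.
Proof.
move=> xN; elim: k => [|k IHk]; first by rewrite mul0r expr0.
rewrite !exprS -IHk; have := lmul_coef 0 xN (bounded_expr (k := k) xN).
rewrite big_ord1 !subr0 => <-; congr (_ _).
by rewrite intS mulrDl mul1r.
Qed.

End Coordinates.

Section Pisot.
Variables (R : realType) (F : finFieldType) (alpha : laurent F).
Hypothesis alpha_PV : PV_element R alpha.

Lemma pisot_inverse : exists d : nat, [/\ (0 < d)%N, alpha != 0,
  bounded_above (alpha^-1)%R (- d%:Z) & (alpha^-1)%R (- d%:Z) != 0].
Proof.
have unb := pisot_unbounded alpha_PV.
have a0 : alpha != 0 by apply: contra_notN unb => /eqP->.
have [ad ab] := ldegP a0; set d := ldeg alpha in ad ab.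
have d0 : 0 < d.
  by rewrite ltNge; apply/negP => d0; apply: unb; exact: bounded_above_le ab.
have ai0 : alpha^-1 != 0 by rewrite invr_eq0.
have [ed eb] := ldegP ai0; set e := ldeg _ in ed eb.
have := lmul_coef 0 ab eb; rewrite mulfV// big_ord1 !subr0 /= => E.
have de : e = - d.
  apply/eqP; rewrite -addr_eq0 addrC; apply: contraT => /negbTE de.
  by move: E; rewrite de => /esym/eqP; rewrite mulf_eq0 (negbTE ad) (negbTE ed).
by exists `|d|%N; rewrite gtz0_abs// -de; split=> //; lia.
Qed.

End Pisot.

Theorem proposition4p4 (R : realType) (F : finFieldType) (alpha : laurent F)
    (alpha_PV : PV_element R alpha) :
  rigidity_sequence R (fun n : nat => int_part (alpha ^+ n)).
Proof.
have [n0 tail0] := pisot_coef_eventually0 alpha_PV.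
have [d [d0 a0 ib it]] := pisot_inverse alpha_PV.
pose beta := alpha^-1; pose K j := (n0.+2 * j.+1)%N.
pose c j := beta (- d%:Z) ^- K j.
have cn0 j : c j != 0 by rewrite /c invr_eq0 expf_neq0.
have Kd0 j : (0 < K j * d)%N by rewrite !muln_gt0 d0.
have Kmono i j : (i < j)%N -> (K i + n0.+2 <= K j)%N.
  by move=> ij; rewrite /K addnC -mulnS leq_mul2l ltnS ij orbT.
have Kge j : (j.+1 + j.+1 <= K j)%N.
  by rewrite /K addnn -mul2n leq_mul2r; apply/orP; right.
have bK j : bounded_above (beta ^+ K j) (- (K j * d)%N%:Z).
  have := bounded_expr (k := K j) ib; rewrite PoszM; congr bounded_above; lia.
have bK0 j : bounded_above (beta ^+ K j) 0.
  by apply: bounded_above_le (bK j); lia.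
pose chi j : {additive {poly F} -> F} := residue_coord (c j) (beta ^+ K j).
have chiE j g : chi j g = c j * (poly_laurent g * beta ^+ K j) (-1) by [].
pose dual j (b : F) : {poly F} := b *: 'X^((K j * d).-1).
have chi_dualE i j b : chi j (dual i b) =
    c j * (b * (beta ^+ K j) (- (K i * d)%N%:Z)).
  rewrite chiE /dual -mul_polyC rmorphM -mulrA.
  have -> : poly_laurent b%:P * (poly_laurent 'X^((K i * d).-1) * beta ^+ K j) =
     poly_laurent 'X^((K i * d).-1) * (poly_laurent b%:P * beta ^+ K j) by ring.
  rewrite mulXn_coef.
  have bC (y : laurent F) n : (poly_laurent b%:P * y) n = b * y n.
    have [N yN] := laurent_bound y.
    have bb : bounded_above (poly_laurent b%:P) 0.
      by move=> [k|k] // k0; rewrite /= coefC; case: k k0.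
    have [nN|Nn] := leP n N; last by rewrite yN// mulr0 (bounded_mul bb yN)// add0r.
    pose k := N - n; have -> : n = 0 + N - `|k|%N%:Z by rewrite /k; lia.
    rewrite (lmul_coef _ bb yN) big_ord_recl big1 => [|i' _]; last first.
      by rewrite (_ : 0 - _ = Negz i') ?mul0r//= /bump; lia.
    by rewrite addr0 subr0 /= coefC eqxx subn0 add0r.
  have -> : -1 - (K i * d).-1%N%:Z = - (K i * d)%N%:Z by have := Kd0 i; lia.
  by rewrite bC.
have chi_int j n : (n0 <= n)%N -> chi j (int_part (alpha ^+ n)) != 0 ->
    (n < K j + n0)%N /\ (K j < n + 2)%N.
  move=> n0n; set r := alpha ^+ n - poly_laurent (int_part (alpha ^+ n)).
  have rb : bounded_above r (-2).
    move=> k k2; have [->|k1] := eqVneq k (-1); last first.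
      by apply: int_part_bounded; lia.
    by rewrite /r /= tail0// subr0.
  have -> : chi j (int_part (alpha ^+ n)) = c j * (alpha ^+ n * beta ^+ K j) (-1).
    rewrite chiE; congr (_ * _).
    rewrite -[poly_laurent _](subKr (alpha ^+ n)) -/r mulrBl /=.
    by rewrite [X in _ - X](bounded_mul rb (bK0 j))// subr0.
  rewrite mulf_eq0 negb_or => /andP[_ ne].
  have [kn|nk] := leqP (K j) n.
    split; last lia.
    rewrite -ltn_subLR//; apply: contraNT ne; rewrite -leqNgt => nk.
    by rewrite -(subnK kn) exprD -mulrA -exprMn mulfV// expr1n mulr1 tail0// subnK.
  split; first lia.
  apply: contraNT ne; rewrite -leqNgt => nk2.
  have -> : alpha ^+ n * beta ^+ K j = beta ^+ (K j - n).
    rewrite -[in LHS](subnK (ltnW nk)) exprD mulrCA -exprMn mulfV//.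
    by rewrite expr1n mulr1.
  rewrite (bounded_expr (k := (K j - n)%N) ib)//.
  have : (2 * 1 <= (K j - n) * d)%N by apply: leq_mul; lia.
  lia.
apply: (@rigidity_sequence_of_coordinates R F {poly F} chi (fun g => size g) dual).
- move=> g k /= sk; rewrite chiE.
  rewrite (bounded_mul (poly_bounded (g := g)) (bK k)) ?mulr0//.
  have : (K k <= K k * d)%N by rewrite leq_pmulr.
  by move: sk (Kge k); move: (size g) (K k * d)%N (K k) => s m l; lia.
- move=> k b; rewrite chi_dualE.
  have -> : (beta ^+ K k) (- (K k * d)%N%:Z) = beta (- d%:Z) ^+ K k.
    by rewrite -(expr_top (K k) ib); congr (_ _); rewrite PoszM; lia.
  by rewrite mulrCA /c mulVf ?mulr1// expf_neq0.
- move=> i k b ik; rewrite chi_dualE bK ?mulr0//.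
  have : (K i * d < K k * d)%N.
    by rewrite ltn_pmul2r//; have := Kmono _ _ ik; lia.
  lia.
- move=> k; near=> n; apply/eqP; apply: contraT => /chi_int[].
    by near: n; exists n0.
  move=> + _; rewrite ltnNge => /negP; case.
  by near: n; exists (K k + n0)%N.
- near=> n => i k ci ck.
  have n0n : (n0 <= n)%N by near: n; exists n0.
  have [i1 i2] := chi_int _ _ n0n ci; have [k1 k2] := chi_int _ _ n0n ck.
  by have [/Kmono|/Kmono|//] := ltngtP i k; lia.
Unshelve. all: by end_near. Qed.
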